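(* There is an absolute constant $C>0$ such that the following holds. Let $N$ be a positive integer, let $\varepsilon > 0$ and let $B^{(1)}, B^{(2)}\subseteq\mathbb{Z}/N\mathbb{Z}$ be regular Bohr sets of rank $d$, where $B^{(2)}$ has radius $\rho$. Suppose that $Y \subseteq B^{(1)}$ and $Z \subseteq B^{(2)}$ are nonempty sets with relative densities $\beta = |Y|/|B^{(1)}|$ and $\gamma = |Z|/|B^{(2)}|$. Let $D \subseteq \mathbb{Z}/N\mathbb{Z}$ be an arbitrary set such that $|Y| \leq |D| \leq 2|B^{(1)}|$. Then there exist a positive quantity $d'$ with \[d' \leq C\,\varepsilon^{-4}\log^3(2\beta^{-1})\log(2\gamma^{-1})\] and a regular Bohr set $B' \subseteq B^{(2)}$ of rank at most $d + d'$ and radius at least $\rho \varepsilon \beta /(24 d^3 d')$ such that \[\Big|\mathbb{E}_{b \in B', y \in B^{(1)}, z \in B^{(2)}} 1_D(z-y + b)1_Y(y)1_Z(z) - \mathbb{E}_{y \in B^{(1)}, z \in B^{(2)}} 1_D(z-y)1_Y(y)1_Z(z)\Big| \leq \varepsilon \beta\gamma.\]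
   Context: $\mathbb{E}_{x\in X}$ denotes $\frac{1}{|X|}\sum_{x\in X}$, and $1_S$ is the indicator function of $S$. For a set $\Gamma \subseteq \mathbb{Z}/N\mathbb{Z}$ and $\rho \geq 0$, the Bohr set with frequency set $\Gamma$ and radius $\rho$ is $\mathrm{Bohr}(\Gamma,\rho)=\{x \in \mathbb{Z}/N\mathbb{Z} : |e(rx/N)-1|\le \rho \text{ for all } r\in\Gamma\}$, where $e(t)=\exp(2\pi i t)$; its rank is $|\Gamma|$. For $B=\mathrm{Bohr}(\Gamma,\rho)$ and real $\delta\ge 0$, the dilate $B_\delta$ is $\mathrm{Bohr}(\Gamma,\delta\rho)$. A Bohr set $B$ of rank $d$ is regular if $1-12d|\delta| \le |B_{1+\delta}|/|B| \le 1+12d|\delta|$ whenever $|\delta|\le 1/(12d)$.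
   Formalization: The formal theorem assumes ε ≤ 1, radius ρ ≤ 2 for B^(2), and d ≥ 1: for large ε or large ρ the required radius forces B' to be all of Z/NZ and the claim fails, and for d = 0 the bounds divide by zero. *)

(* Defs.v *)
From HB Require Import structures.
From mathcomp Require Import all_boot all_order all_algebra.
From mathcomp Require Import all_classical all_reals all_analysis.
From mathcomp Require Export complex.

Set Implicit Arguments.
Unset Strict Implicit.
Unset Printing Implicit Defensive.

Import Order.TTheory GRing.Theory Num.Theory.
Local Open Scope ring_scope.

(* Z/NZ with N = n.+1 is the additive group 'I_n.+1, which, unlike 'Z_N, is
   correct for N = 1 as well. *)

Definition e (R : realType) (t : R) : R[i] :=
  Complex (cos (2 * pi * t)) (sin (2 * pi * t)).

Definition Bohr (R : realType) (n : nat) (Gamma : {set 'I_n.+1}) (rho : R) :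
    {set 'I_n.+1} :=
  [set x : 'I_n.+1 |
    [forall r in Gamma, `|e ((r * x)%N%:R / n.+1%:R : R) - 1| <= rho%:C%C]].

(* Rank, radius and dilates depend on the pair (Gamma, rho), not only on the
   underlying set, so a Bohr set is given by that pair; its dilate by
   delta >= 0 is Bohr Gamma (delta * rho).
   The division in the bound on delta is by 0 when Gamma = set0, which leaves
   only delta = 0; this loses nothing, as Bohr set0 rho is the whole group
   for every rho. *)
Definition regular_Bohr (R : realType) (n : nat) (Gamma : {set 'I_n.+1})
    (rho : R) : Prop :=
  let d : R := #|Gamma|%:R in
  forall delta : R, `|delta| <= 1 / (12 * d) ->
    1 - 12 * d * `|delta|
      <= #|Bohr Gamma ((1 + delta) * rho)|%:R / #|Bohr Gamma rho|%:R
      <= 1 + 12 * d * `|delta|.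

Definition expect (R : realType) (T : finType) (X : {set T}) (f : T -> R) : R :=
  #|X|%:R^-1 * \sum_(x in X) f x.

Notation "\E_ ( x 'in' X ) F" := (expect X (fun x => F))
  (at level 41, F at level 41, x, X at level 50,
   format "\E_ ( x  'in'  X )  F") : ring_scope.

Definition ind (R : realType) (T : finType) (S : {set T}) (x : T) : R :=
  (x \in S)%:R.
Arguments ind R {T} S x.

(* Main.v *)
(** Write [G(b)] for the number of pairs [(y, z)] in [Y * Z] with [z - y + b] in
    [D]; the claim is that averaging [G] over a suitable Bohr set [B'] moves
    [G(0)] by at most [eps * |Y| * |Z|].

    Sampling [Z] (Croot-Sisask) yields a large [T], contained in a narrow dilate
    [S] of [B2], such that [G(w + t)] and [G(w + t')] are close for all [w] and
    all [t], [t'] in [T].  Hence replacing [G] by its [k]-fold average over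
    [T - t0] changes it little, while the Fourier transform of that average is
    negligible at the frequencies outside the set of [r] where the Fourier
    transform of the uniform measure on [T] is at least [1/2].  By a version of
    Chang's theorem relative to [S], this set is spanned, up to characters almost
    constant on a dilate of [S], by few characters; adding those to the frequency
    set of [B2] and shrinking the radius makes every character of the set almost
    constant on [B'].  A regular radius exists by the rising sun lemma applied to
    [t |-> ln |Bohr(Gamma, e^t)|]. *)
Require Import Defs.
From mathcomp Require Import all_boot all_order all_algebra.
From mathcomp Require Import all_classical all_reals all_analysis.
From mathcomp Require Import ring lra zify.
Import Order.TTheory GRing.Theory Num.Theory.
Local Open Scope ring_scope.

Set Implicit Arguments.
Unset Strict Implicit.
Unset Printing Implicit Defensive.
Import ComplexField.Normc.

(** * Characters and Bohr sets *)

(** The size of the new frequency set comes from coupled parameters. As [D] may exceed [Y] by a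
    factor [2 / beta], the Fourier tail must be pushed down to order [eps * beta], which fixes the
    number [k] of averages. Each average costs one sampling error, so the sampling precision [eta]
    is [eps / (8 * k)], and [m] of order [ln (2 / beta) / eta ^+ 2] samples are drawn. [T] then has
    density about [(gamma / 2) ^+ m] in [S], and Chang's theorem returns about [m * ln (2 / gamma)]
    characters: one logarithm of [2 / beta] comes directly from [m], two from [k ^+ 2]. Relative to
    a Bohr set, dissociativity cannot mean avoiding the frequency 0 alone: the whole spectrum of a
    smaller Bohr set [S'] is avoided, and regularity makes its characters almost constant on
    narrower dilates. Hence regular radii are needed at every scale, not only for the final set. *)

Section Characters.
Variable R : realType.
Implicit Types (s t : R) (z w : R[i]).

Lemma normcE z : `|z| = (normc z)%:C%C.
Proof. by []. Qed.

Lemma normc_ge0 z : 0 <= normc z.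
Proof. by rewrite -lecR -normcE normr_ge0. Qed.

Lemma normc_sum (I : Type) (r : seq I) (P : pred I) (F : I -> R[i]) :
  normc (\sum_(i <- r | P i) F i) <= \sum_(i <- r | P i) normc (F i).
Proof.
elim/big_ind2: _ => [|z s w t hz hw|//]; first by rewrite normc0.
exact: le_trans (le_normcD _ _) (lerD hz hw).
Qed.

Lemma normcX z k : normc (z ^+ k) = normc z ^+ k.
Proof.
elim: k => [|k IH]; first by rewrite !expr0 normc1.
by rewrite !exprS normcM IH.
Qed.

Lemma normc_real t : normc t%:C%C = `|t|.
Proof. by rewrite /= expr0n addr0 sqrtr_sqr. Qed.

Lemma normc_Re z : `|complex.Re z| <= normc z.
Proof.
case: z => a b /=; rewrite -sqrtr_sqr ler_wsqrtr //.
by rewrite lerDl sqr_ge0.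
Qed.

Lemma normc_Im z : `|complex.Im z| <= normc z.
Proof.
case: z => a b /=; rewrite -sqrtr_sqr ler_wsqrtr //.
by rewrite lerDr sqr_ge0.
Qed.

Lemma normc_leP (z : R[i]) (c : R) : 0 <= c ->
  (complex.Re z) ^+ 2 + (complex.Im z) ^+ 2 <= c ^+ 2 -> normc z <= c.
Proof.
case: z => a b /= c0 h; rewrite -[leRHS](ger0_norm c0) -sqrtr_sqr.
exact: ler_wsqrtr.
Qed.

Lemma normc_conj z : normc z^*%C = normc z.
Proof. by case: z => a b /=; rewrite sqrrN. Qed.

Lemma mul_conjc z : z^*%C * z = (normc z ^+ 2)%:C%C.
Proof.
case: z => a b; apply/eqP; rewrite eq_complex /= sqr_sqrtr; last first.
  by rewrite addr_ge0 ?sqr_ge0.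
by apply/andP; split; apply/eqP; ring.
Qed.

Lemma Re_sum (I : Type) (r : seq I) (P : pred I) (F : I -> R[i]) :
  complex.Re (\sum_(i <- r | P i) F i) = \sum_(i <- r | P i) complex.Re (F i).
Proof. by apply: (big_morph (@complex.Re R)) => // -[a b] [c u]. Qed.

Lemma eD s t : e (s + t) = e s * e t.
Proof. by rewrite /e mulrDr cosD sinD; apply/eqP; rewrite eq_complex /= eqxx addrC mulrC [X in _ + X]mulrC eqxx. Qed.

Lemma e_nat k : e (k%:R : R) = 1.
Proof.
elim: k => [|k IH]; first by rewrite /e mulr0 cos0 sin0.
rewrite -natr1 eD IH mul1r /e mulr1 (mulrC 2) mulr_natr cos2pi sin2pi.
by [].
Qed.

Lemma normc_e t : normc (e t) = 1.
Proof. by rewrite /= cos2Dsin2 sqrtr1. Qed.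

Lemma e_neq1 t : 0 < t < 1 -> e t != 1.
Proof.
move=> /andP[t0 t1]; apply/eqP => -[].
rewrite -mulrA mulrC mulr_natr cos_mulr2n => hc _.
have := sin_gt0_pi _ (x := pi * t); rewrite pmulr_rgt0 ?pi_gt0 // t0 gtr_pMr ?pi_gt0 // t1.
move=> /(_ isT); have := cos2Dsin2 (pi * t) => h1 h2.
have : sin (pi * t) ^+ 2 = 0 by lra.
by move/eqP; rewrite sqrf_eq0 => /eqP h; rewrite h ltxx in h2.
Qed.

Variable n : nat.
Local Notation G := 'I_n.+1.
Implicit Types (r x y : G).

Definition chi r x : R[i] := e ((r * x)%N%:R / n.+1%:R).

Lemma chiC r x : chi r x = chi x r.
Proof. by rewrite /chi mulnC. Qed.

Lemma e_mod k : e ((k %% n.+1)%N%:R / n.+1%:R : R) = e (k%:R / n.+1%:R).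
Proof.
rewrite {2}(divn_eq k n.+1) natrD natrM mulrDl mulfK ?pnatr_eq0 //.
by rewrite eD e_nat mul1r.
Qed.

Lemma chiD r x y : chi r (x + y) = chi r x * chi r y.
Proof.
rewrite /chi -eD -mulrDl -natrD -mulnDr /= -[LHS]e_mod modnMmr.
exact: e_mod.
Qed.

Lemma chi0 r : chi r 0 = 1.
Proof. by rewrite /chi muln0 mul0r -[0]/(0%N%:R) e_nat. Qed.

Lemma normc_chi r x : normc (chi r x) = 1.
Proof. exact: normc_e. Qed.

Lemma mul_conj_chi r x : (chi r x)^*%C * chi r x = 1.
Proof.
apply/eqP; rewrite /chi /e /= eq_complex /=; apply/andP; split; apply/eqP.
  by rewrite -[RHS](cos2Dsin2 (2 * pi * ((r * x)%N%:R / n.+1%:R))); ring.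
by ring.
Qed.

Lemma chiN r x : chi r (- x) = (chi r x)^*%C.
Proof.
have h : chi r (-x) * chi r x = 1 by rewrite -chiD addNr chi0.
by rewrite -[LHS]mulr1 -(mul_conj_chi r x) mulrCA h mulr1.
Qed.

Lemma chiDl r r' x : chi (r + r') x = chi r x * chi r' x.
Proof. by rewrite chiC chiD !(chiC x). Qed.
Lemma chi0l x : chi 0 x = 1. Proof. by rewrite chiC chi0. Qed.
Lemma chiNl r x : chi (- r) x = (chi r x)^*%C.
Proof. by rewrite chiC chiN chiC. Qed.

(** Orthogonality of characters. For [x != 0] the group is nontrivial, and translating the index by
    the element [o], which is 1, multiplies the sum by [chi o x], different from 1. *)
Lemma sum_chi x : \sum_r chi r x = n.+1%:R *+ (x == 0).
Proof.
have [->|x0] := eqVneq x 0.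
  by under eq_bigr do rewrite chi0; rewrite sumr_const card_ord mulr1n.
rewrite mulr0n; set S := \sum_ _ _.
have n0 : (0 < n)%N.
  rewrite lt0n; apply: contra x0 => /eqP n0; rewrite -val_eqE /=.
  by move: (ltn_ord x) n0; lia.
pose o : G := Ordinal (n0 : (1 < n.+1)%N).
have hS : S = chi o x * S.
  rewrite mulr_sumr /S (reindex_inj (addrI o)) /=.
  by apply: eq_bigr => r _; rewrite chiDl.
have ho : chi o x != 1.
  apply: e_neq1; rewrite /= mul1n divr_gt0 ?ltr0n ?lt0n //=.
  by rewrite ltr_pdivrMr ?ltr0n // mul1r ltr_nat.
apply/eqP; move/eqP: hS; rewrite -subr_eq0 -{1}[S]mul1r -mulrBl mulf_eq0 subr_eq0.
by rewrite eq_sym (negPf ho).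
Qed.

Lemma mem_Bohr (Gamma : {set G}) (rho : R) x :
  reflect (forall r, r \in Gamma -> normc (chi r x - 1) <= rho) (x \in Bohr Gamma rho).
Proof.
rewrite inE; apply: (iffP forall_inP) => h r /h; by rewrite normcE lecR.
Qed.

Lemma normc_chiD r x y :
  normc (chi r (x + y) - 1) <= normc (chi r x - 1) + normc (chi r y - 1).
Proof.
have -> : chi r (x + y) - 1 = chi r x * (chi r y - 1) + (chi r x - 1).
  by rewrite chiD; ring.
apply: le_trans (le_normcD _ _) _.
by rewrite normcM normc_chi mul1r addrC.
Qed.

Lemma normc_chiN r x : normc (chi r (- x) - 1) = normc (chi r x - 1).
Proof. by rewrite chiN; case: (chi r x) => a b /=; rewrite oppr0 !addr0 sqrrN. Qed.

Implicit Types (Gamma : {set G}) (rho : R).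

Lemma BohrD Gamma rho rho' x y :
  x \in Bohr Gamma rho -> y \in Bohr Gamma rho' -> x + y \in Bohr Gamma (rho + rho').
Proof.
move=> /mem_Bohr hx /mem_Bohr hy; apply/mem_Bohr => r rG.
exact: le_trans (normc_chiD _ _ _) (lerD (hx _ rG) (hy _ rG)).
Qed.

Lemma Bohr0 Gamma rho : 0 <= rho -> 0 \in Bohr Gamma rho.
Proof. by move=> h; apply/mem_Bohr => r _; rewrite chi0 subrr normc0. Qed.

Lemma Bohr_card_gt0 Gamma rho : 0 <= rho -> (0 < #|Bohr Gamma rho|)%N.
Proof. by move=> h; apply/card_gt0P; exists 0; exact: Bohr0. Qed.

Lemma BohrS Gamma Gamma' rho rho' : Gamma \subset Gamma' -> rho' <= rho ->
  Bohr Gamma' rho' \subset Bohr Gamma rho.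
Proof.
move=> /fintype.subsetP hG hr; apply/fintype.subsetP => x /mem_Bohr hx; apply/mem_Bohr => r /hG /hx h.
exact: le_trans h hr.
Qed.

Lemma Bohr_leq_card Gamma rho rho' : rho' <= rho ->
  (#|Bohr Gamma rho'| <= #|Bohr Gamma rho|)%N.
Proof. by move=> h; apply/subset_leq_card/BohrS. Qed.

End Characters.

Arguments normc : simpl never.
Arguments chi : simpl never.

(** * Growth of Bohr sets *)

Lemma card_le_fibers (T U : finType) (A : {set T}) (B : {pred U}) (f : T -> U) K :
  (forall x, x \in A -> f x \in B) ->
  (forall u, (#|[set x in A | f x == u]| <= K)%N) -> (#|A| <= #|B| * K)%N.
Proof.
move=> hf hK; rewrite -sum1_card (partition_big f (mem B)) //=.
rewrite -sum_nat_const; apply: leq_sum => u _.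
apply: leq_trans (hK u); rewrite -sum1_card; apply: eq_leq.
by apply: eq_bigl => x; rewrite !inE.
Qed.

Section Growth.
Variables (R : realType) (n : nat).
Local Notation G := 'I_n.+1.
Implicit Types (Gamma : {set G}) (rho : R) (x y r : G).

Lemma normc_chiB r x y : normc (chi R r (x - y) - 1) = normc (chi R r x - chi R r y).
Proof.
have -> : chi R r (x - y) - 1 = chi R r (- y) * (chi R r x - chi R r y).
  by rewrite mulrBr -!chiD addNr chi0 (addrC x).
by rewrite normcM normc_chi mul1r.
Qed.

(* Squares of side [rho / 15], whose diagonal is at most [rho / 10]; the
   coordinates fill [31] of the [32] values. *)
Definition cell rho (t : R) : 'I_32 := inord (Num.truncn ((t + rho) * 15 / rho)).

Lemma cell_eq rho t t' : 0 < rho -> `|t| <= rho -> `|t'| <= rho ->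
  cell rho t = cell rho t' -> (t - t') ^+ 2 <= (rho / 15) ^+ 2.
Proof.
move=> r0 ht ht' /(congr1 (@nat_of_ord _)).
have rn : rho != 0 by rewrite gt_eqF.
have hb s : `|s| <= rho -> 0 <= (s + rho) * 15 / rho <= 30.
  rewrite ler_norml => /andP[h1 h2]; apply/andP; split.
    by apply: divr_ge0; lra.
  by rewrite ler_pdivrMr //; lra.
have hs s : `|s| <= rho -> nat_of_ord (cell rho s) = Num.truncn ((s + rho) * 15 / rho).
  move=> /hb /andP[h1 h2]; rewrite inordK // -(ltr_nat R).
  by have /andP[h3 _] := truncn_itv h1; apply: le_lt_trans h3 _; lra.
rewrite !hs // => heq.
have /andP[/truncn_itv /andP[a1 a2] _] := hb _ ht.
have /andP[/truncn_itv /andP[b1 b2] _] := hb _ ht'.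
rewrite -heq in b1 b2.
set k := Num.truncn _ in a1 a2 b1 b2.
have hk : k.+1%:R = k%:R + 1 :> R by rewrite natr1.
rewrite hk in a2 b2.
have e1 : (t + rho) * 15 / rho - (t' + rho) * 15 / rho = (t - t') * 15 / rho by field.
have h : -1 <= (t - t') * 15 / rho <= 1 by lra.
have -> : t - t' = (t - t') * 15 / rho * (rho / 15) by field.
rewrite exprMn -[leRHS]mul1r ler_wpM2r ?sqr_ge0 //.
by nra.
Qed.

(** Pigeonhole over the [32 * 32] cells of each frequency: two points with equal cells at every
    frequency of [Gamma] differ by an element of the smaller Bohr set, so a fibre, translated by one
    of its points, lands there. *)
Lemma Bohr_growth Gamma rho : 0 < rho ->
  (#|Bohr Gamma rho| <= 1024 ^ #|Gamma| * #|Bohr Gamma (rho / 10)|)%N.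
Proof.
move=> r0.
(* Default cell off [Gamma]: it confines [f] to functions supported on [Gamma], which brings the
   exponent down to [#|Gamma|]. *)
pose z0 : 'I_32 * 'I_32 := (ord0, ord0).
pose f x : {ffun G -> 'I_32 * 'I_32} := [ffun r => if r \in Gamma then
  (cell rho (complex.Re (chi R r x - 1)), cell rho (complex.Im (chi R r x - 1))) else z0].
have -> : 1024%N = #|{: 'I_32 * 'I_32}| by rewrite card_prod !card_ord.
rewrite -(card_pffun_on z0); apply: (card_le_fibers (f := f)) => [x _|u].
  apply/pffun_onP; split=> // ; apply/supportP => r rG.
  by rewrite ffunE (negPf rG).
have [->|[x0]] := set_0Vmem [set x in Bohr Gamma rho | f x == u]; first by rewrite cards0.
rewrite inE => /andP[hx0 /eqP fx0].
rewrite -(card_imset _ (addIr (- x0))); apply/subset_leq_card/fintype.subsetP => y /imsetP[x].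
rewrite inE => /andP[hx /eqP fx] ->; apply/mem_Bohr => r rG.
move/mem_Bohr: hx => /(_ r rG) hx; move/mem_Bohr: hx0 => /(_ r rG) hx0.
move: fx; rewrite -fx0 => /ffunP/(_ r); rewrite !ffunE rG => -[h1 h2].
have k1 := cell_eq r0 (le_trans (normc_Re _) hx) (le_trans (normc_Re _) hx0) h1.
have k2 := cell_eq r0 (le_trans (normc_Im _) hx) (le_trans (normc_Im _) hx0) h2.
rewrite normc_chiB; apply: normc_leP; first by rewrite divr_ge0 // ltW.
move: k1 k2; case: (chi R r x) => a b; case: (chi R r x0) => a' b' /=.
have -> : a - 1 - (a' - 1) = a - a' by ring.
have -> : b + - 0 - (b' + - 0) = b - b' by ring.
have := sqr_ge0 rho.
have -> : (rho / 15) ^+ 2 = rho ^+ 2 / 225 by field.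
have -> : (rho / 10) ^+ 2 = rho ^+ 2 / 100 by field.
by move=> *; lra.
Qed.

End Growth.

(** * Existence of a regular radius *)

Section RisingSun.
Variable R : realType.

Fixpoint runmin (M0 : R) (q : nat -> R) (j : nat) : R :=
  if j is i.+1 then Num.min (runmin M0 q i) (q i) else M0.

Lemma runmin_le M0 q j : runmin M0 q j <= M0.
Proof. by elim: j => //= j IH; rewrite ge_min IH. Qed.

Lemma runmin_le_nth M0 q i j : (i < j)%N -> runmin M0 q j <= q i.
Proof.
elim: j => //= j IH; rewrite ltnS leq_eqVlt => /orP[/eqP->|/IH h].
  by rewrite ge_min lexx orbT.
by rewrite ge_min h.
Qed.

(** Picture a graph that falls from [p j] to [q j] on piece [j] and jumps up between pieces. The
    running minimum from the left and the running maximum from the right each descend by at least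
    [M0 - M1]; when the total fall is less than twice that, both descend through a common level
    inside one piece. *)
Lemma record_level (p q : nat -> R) (m : nat) (M0 M1 : R) :
  (0 < m)%N ->
  (forall j, (j < m)%N -> q j <= p j) ->
  (forall j, (j.+1 < m)%N -> q j <= p j.+1) ->
  M0 <= p 0%N -> q m.-1 <= M1 ->
  \sum_(0 <= j < m) (p j - q j) < 2 * (M0 - M1) ->
  exists j y, [/\ (j < m)%N, q j < y <= p j, M1 <= y <= M0,
    (forall i, (i < j)%N -> y <= q i) & (forall i, (j < i < m)%N -> p i <= y)].
Proof.
move=> m0 hqp hqpS h0 h1 hsum.
pose M := runmin M0 q.
(* Running maximum of [M1] and of the [p i] with [i >= j], as a running minimum of the reversed,
   negated sequence. *)
pose T j := - runmin (- M1) (fun i => - p (m.-1 - i)%N) (m - j).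
have Tm : T m = M1 by rewrite /T subnn /= opprK.
have TS j : (j < m)%N -> T j = Num.max (T j.+1) (p j).
  move=> jm; rewrite /T (_ : m - j = (m - j.+1).+1)%N; last lia.
  rewrite /= (_ : m.-1 - (m - j.+1) = j)%N; last lia.
  by rewrite oppr_min opprK.
have T1 j : M1 <= T j by rewrite /T lerNr runmin_le.
have Tp i j : (j <= i < m)%N -> p i <= T j.
  move=> h; rewrite /T lerNr.
  have -> : - p i = - p (m.-1 - (m.-1 - i))%N by congr (- p _); lia.
  by apply: (@runmin_le_nth _ (fun i => - p (m.-1 - i)%N)); lia.
have Mp j : (j < m)%N -> M j <= p j.
  case: j => // j jm; apply: le_trans (hqpS _ jm).
  exact: runmin_le_nth.
have Tq j : (j < m)%N -> q j <= T j.+1.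
  move=> jm; have [jm'|jm'] := ltnP j.+1 m.
    by apply: le_trans (hqpS _ jm') (Tp _ _ _); rewrite leqnn.
  have -> : j.+1 = m by lia.
  by rewrite Tm; apply: le_trans h1; rewrite (_ : m.-1 = j) //; lia.
have [j jm hj] : exists2 j, (j < m)%N &
    p j - q j < (M j - M j.+1) + (T j - T j.+1).
  apply: contrapT => hno; move: hsum; apply/negP; rewrite -leNgt.
  apply: (@le_trans _ _ (\sum_(0 <= j < m) ((M j - M j.+1) + (T j - T j.+1)))).
    have tel (F : nat -> R) : \sum_(0 <= j < m) (F j - F j.+1) = F 0%N - F m.
      by under eq_bigr do rewrite -opprB; rewrite sumrN telescope_sumr // opprB.
    rewrite big_split /= !tel.
    have a : M m <= M1 by apply: le_trans h1; apply: runmin_le_nth; lia.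
    have b : M0 <= T 0%N by apply: le_trans h0 _; apply: Tp.
    by rewrite Tm /M /= -/M; lra.
  rewrite !big_nat; apply: ler_sum => j /andP[_ jm].
  by rewrite leNgt; apply/negP => h; apply: hno; exists j.
(* Two drops inside [[q j, p j]] that add up to more than its length overlap; [M j] is a level in
   the overlap. *)
exists j, (M j).
have hMS : M j.+1 = Num.min (M j) (q j) by [].
have := hqp _ jm; have := Mp _ jm; have := Tq _ jm => k1 k2 k3.
have [k4 k5] : q j < M j /\ T j.+1 <= M j.
  move: hj; rewrite hMS TS //.
  by case: (leP (M j) (q j)) => k4; case: (leP (T j.+1) (p j)) => k5 hj; split; lra.
split=> //.
- by rewrite k4.
- by rewrite runmin_le andbT; apply: le_trans (T1 _) k5.
- by move=> i; apply: runmin_le_nth.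
- by move=> i h; apply: le_trans k5; apply: Tp.
Qed.


Lemma itv_locate (v : nat -> R) m t : (forall j, (j < m)%N -> v j < v j.+1) ->
  v 0%N <= t < v m -> exists2 j, (j < m)%N & v j <= t < v j.+1.
Proof.
elim: m => [|m IH] hv /andP[h0 hm]; first by have := le_lt_trans h0 hm; rewrite ltxx.
have [h|h] := leP (v m) t; first by exists m => //; rewrite h.
have [|j jm hj] := IH (fun j jm => hv j (ltnW jm)); first by rewrite h0.
by exists j => //; rewrite ltnW.
Qed.

(* The rising sun lemma for the jump function [t |-> a t - c * t], applied
   from the left and from the right: the points where it is a running minimum
   and those where it is a running maximum from the right both fill more than
   half of the interval, hence they meet. *)
Lemma rising_sun (a : R -> R) (c al be A B : R) (V : seq R) :
  0 < c -> al < be -> {homo a : s t / s <= t} ->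
  (forall s t, al <= s <= t -> t < be -> (forall v, v \in V -> ~~ (s < v <= t)) ->
     a t = a s) ->
  A <= a al -> a be <= B -> 2 * (B - A) < c * (be - al) ->
  exists s, [/\ al <= s < be,
    forall t, al <= t <= s -> a s - a t <= c * (s - t),
    forall t, s <= t <= be -> a t - a s <= c * (t - s),
    a s - c * s <= A - c * al & B - c * be <= a s - c * s].
Proof.
move=> c0 hab amono hstep hA hB hBA.
(* Break points: between consecutive ones [a] is constant, so [a t - c * t] falls at rate [c]. *)
pose S := sort <=%R (undup (al :: be :: [seq v <- V | al < v < be])).
have Ssort : sorted <%R S by rewrite sort_lt_sorted undup_uniq.
have memS x : (x \in S) = [|| x == al, x == be | (al < x < be) && (x \in V)].
  by rewrite mem_sort mem_undup !inE mem_filter.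
have S_itv x : x \in S -> al <= x <= be.
  rewrite memS => /or3P[/eqP->|/eqP->|/andP[/andP[h1 h2] _]]; first by rewrite lexx ltW.
  - by rewrite lexx ltW.
  - by rewrite !ltW.
pose m := (size S).-1.
have Sgt0 : (0 < size S)%N.
  by have : al \in S; [rewrite memS eqxx | case: (S)].
have hSm : size S = m.+1 by rewrite /m prednK.
pose v := nth 0 S.
have vS j : (j <= m)%N -> v j \in S by move=> h; rewrite mem_nth // hSm ltnS.
have vmono : forall i j, (j <= m)%N -> (i < j)%N -> v i < v j.
  move=> i j hj ij; rewrite /v.
  by apply: (sorted_ltn_nth lt_trans) => //; rewrite inE hSm; lia.
have vmono' i j : (j <= m)%N -> (i <= j)%N -> v i <= v j.
  by move=> hj; rewrite leq_eqVlt => /orP[/eqP->//|h]; rewrite ltW // vmono.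
have Sv x : x \in S -> exists2 i, (i <= m)%N & x = v i.
  by move=> xS; exists (index x S); [rewrite -ltnS -hSm index_mem | rewrite /v nth_index].
have v0 : v 0%N = al.
  have [|i im hi] := Sv al; first by rewrite memS eqxx.
  by apply/eqP; rewrite eq_le {1}hi vmono' //=; have /andP[] := S_itv _ (vS _ (leq0n _)).
have vm : v m = be.
  have [|i im hi] := Sv be; first by rewrite memS eqxx orbT.
  by apply/eqP; rewrite eq_le {2}hi vmono' // andbT; have /andP[] := S_itv _ (vS _ (leqnn _)).
have m0 : (0 < m)%N.
  by rewrite lt0n; apply: contraTneq hab => h; rewrite -v0 -vm h ltxx.
have piece j t : (j < m)%N -> v j <= t < v j.+1 -> a t = a (v j).
  move=> jm /andP[h1 h2]; have /andP[h3 _] := S_itv _ (vS j (ltnW jm)).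
  have /andP[_ h4] := S_itv _ (vS j.+1 jm).
  apply: hstep; rewrite ?h3 ?(lt_le_trans h2) //.
  move=> x xV; apply/negP => /andP[h5 h6].
  have [|i im hi] := Sv x.
    by rewrite memS xV andbT (le_lt_trans h3 h5) (le_lt_trans h6 (lt_le_trans h2 h4)) !orbT.
  have : (i <= j)%N.
    rewrite leqNgt; apply/negP => ji; have := vmono' _ _ im ji.
    by rewrite -hi leNgt (le_lt_trans h6 h2).
  by move=> /(vmono' _ _ (ltnW jm)); rewrite -hi leNgt h5.
(* [p j] is the value of [a t - c * t] at the left end of a piece, [q j] its limit at the right
   end. *)
have [|||||j [y [jm /andP[y1 y2] /andP[y3 y4] y5 y6]]] :=
  @record_level (fun j => a (v j) - c * v j) (fun j => a (v j) - c * v j.+1) m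
   (A - c * al) (B - c * be) m0.
- by move=> j jm; rewrite lerD2l lerN2 ler_pM2l // vmono'.
- by move=> j jm; rewrite lerD2r; apply: amono; rewrite vmono' // ltnW.
- by rewrite v0 lerD2r.
- rewrite prednK // vm lerD2r; apply: le_trans hB; apply: amono.
  by rewrite -vm vmono' // leq_pred.
- rewrite (eq_big_nat _ _ (F2 := fun j => c * v j.+1 - c * v j)); last by move=> j _; ring.
  by rewrite (telescope_sumr (fun j => c * v j)) // v0 vm; lra.
(* The point of piece [j] where [a t - c * t] takes the value [y]. *)
pose s := (a (v j) - y) / c.
have cs : c * s = a (v j) - y by rewrite mulrC divfK // gt_eqF.
have hs : v j <= s < v j.+1.
  by rewrite -(ler_pM2l c0) -(ltr_pM2l c0) cs; apply/andP; split; lra.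
have as_ : a s = a (v j) by apply: piece.
have vj := vmono' _ _ (ltnW jm) (leq0n j); have vj1 := vmono' _ _ (leqnn m) jm.
rewrite v0 in vj; rewrite vm in vj1; have /andP[hs1 hs2] := hs.
have vmono1 i : (i < m)%N -> v i < v i.+1 by move=> h; apply: vmono.
exists s; split.
- by rewrite (le_trans vj hs1) (lt_le_trans hs2 vj1).
- move=> t /andP[t1 t2]; have [|i im /andP[i1 i2]] := @itv_locate v m t vmono1.
    by rewrite v0 vm t1 (le_lt_trans t2) // (lt_le_trans hs2).
  rewrite as_ (piece i t) ?i1 //.
  have [ij|] := ltnP i j.
    have /= k1 := y5 _ ij; have k2 : c * t <= c * v i.+1 by rewrite ler_pM2l // ltW.
    by rewrite mulrBr cs; lra.
  move=> ji; have -> : i = j.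
    by apply/eqP; rewrite eqn_leq ji andbT leqNgt; apply/negP => /(vmono' _ _ (ltnW im)); lra.
  by rewrite subrr; apply: mulr_ge0; lra.
- move=> t /andP[t1]; rewrite le_eqVlt => /orP[/eqP->|t2].
    by rewrite as_; lra.
  have [|i im /andP[i1 i2]] := @itv_locate v m t vmono1.
    by rewrite v0 vm t2 (le_trans _ t1) // (le_trans vj).
  rewrite as_ (piece i t) ?i1 //.
  have [ji|] := ltnP j i.
    have := y6 i; rewrite ji im => /(_ isT) /= k1.
    have k2 : c * v i <= c * t by rewrite ler_pM2l.
    by rewrite mulrBr cs; lra.
  move=> ij; have -> : i = j.
    by apply/eqP; rewrite eqn_leq ij /= leqNgt; apply/negP => /(vmono' _ _ (ltnW jm)); lra.
  by rewrite subrr; apply: mulr_ge0; lra.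
- by rewrite as_ cs; lra.
- by rewrite as_ cs; lra.
Qed.

End RisingSun.

(** * Regularity on the logarithmic scale *)

Section RegularRadius.
Variables (R : realType) (n : nat).
Local Notation G := 'I_n.+1.
Implicit Types (Gamma : {set G}) (rho : R) (x y r : G).

Lemma expR_le_inv (v : R) : v < 1 -> expR v <= (1 - v)^-1.
Proof.
move=> v1; have h : 0 < 1 - v by lra.
rewrite -[v in leLHS]opprK expRN lef_pV2 ?posrE ?expR_gt0 //.
exact: expR_ge1Dx.
Qed.

(** A single use of [expR v <= (1 - v)^-1] at [v = 7 / 12 * y] is too weak at [y = 1]; used at half
    the exponent and squared, it suffices. *)
Lemma expR_le_regular (y : R) : 0 <= y <= 1 -> expR (7 / 12 * y) <= 1 + y.
Proof.
move=> /andP[y0 y1].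
have -> : 7 / 12 * y = 7 / 24 * y + 7 / 24 * y by lra.
rewrite expRD; have h : 7 / 24 * y < 1 by lra.
have k := expR_le_inv h; have k0 := expR_ge0 (7 / 24 * y).
have z : 0 < 1 - 7 / 24 * y by lra.
apply: (le_trans (ler_pM k0 k0 k k)).
rewrite -invfM -div1r ler_pdivrMr ?mulr_gt0 //.
have : 0 <= y * ((1 - y) * (34 / 7 - y)).
  by apply: mulr_ge0 => //; apply: mulr_ge0; lra.
by lra.
Qed.

Lemma bernoulli_le (eta : R) k : 0 <= eta <= 1 -> 1 - k%:R * eta <= (1 - eta) ^+ k.
Proof.
move=> /andP[h0 h1]; elim: k => [|k IH]; first by rewrite mul0r subr0 expr0.
rewrite exprS -natr1; have k0 : 0 <= k%:R * eta by rewrite mulr_ge0.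
have h : (1 - eta) * (1 - k%:R * eta) <= (1 - eta) * (1 - eta) ^+ k.
  by apply: ler_wpM2l => //; lra.
apply: le_trans h; have : 0 <= k%:R * eta * eta by rewrite mulr_ge0.
by lra.
Qed.

Lemma ln_Bohr_le Gamma rho rho' : 0 <= rho -> rho <= rho' ->
  ln (#|Bohr Gamma rho|%:R : R) <= ln #|Bohr Gamma rho'|%:R.
Proof.
move=> h0 h; rewrite ler_ln ?posrE ?ltr0n ?Bohr_card_gt0 ?(le_trans h0) //.
by rewrite ler_nat Bohr_leq_card.
Qed.

Lemma ln1D_le_regular (d : nat) (delta : R) : 0 <= delta ->
  12 * d%:R * delta <= 1 -> 7 * d%:R * ln (1 + delta) <= ln (1 + 12 * d%:R * delta).
Proof.
move=> h0 h1; have p0 : 0 <= 12 * d%:R * delta by rewrite !mulr_ge0.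
apply: (@le_trans _ _ (7 / 12 * (12 * d%:R * delta))).
  have -> : 7 / 12 * (12 * d%:R * delta) = 7 * d%:R * delta by field.
  by apply: ler_wpM2l; [rewrite mulr_ge0 | apply: le_ln1Dx; lra].
rewrite -ler_expR lnK ?posrE; last lra.
by apply: expR_le_regular; rewrite p0.
Qed.

(** The upper bound for [delta >= 0] follows from the exponential estimate, the lower bound for
    [delta < 0] from Bernoulli's inequality; the two other bounds are monotonicity of Bohr sets in
    the radius. *)
Lemma regular_of_ln_card Gamma rho : (0 < #|Gamma|)%N -> 0 < rho ->
  let card (t : R) : R := #|Bohr Gamma t|%:R in
  (forall delta, 0 <= delta <= 1 / 12 ->
     ln (card ((1 + delta) * rho)) - ln (card rho) <= 7 * #|Gamma|%:R * ln (1 + delta)) ->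
  (forall delta, - (1 / 12) <= delta <= 0 ->
     ln (card rho) - ln (card ((1 + delta) * rho)) <= - (7 * #|Gamma|%:R * ln (1 + delta))) ->
  regular_Bohr Gamma rho.
Proof.
move=> d0 rho0 card hup hdown; cbv zeta beta delta [regular_Bohr] => delta.
set d := #|Gamma| in d0 hup hdown *.
have d1 : 1 <= d%:R :> R by rewrite ler1n.
have cardgt0 t : 0 <= t -> 0 < card t by move=> h; rewrite ltr0n Bohr_card_gt0.
have cl0 := cardgt0 _ (ltW rho0); move=> hd.
have hdy : 12 * d%:R * `|delta| <= 1.
  by move: hd; rewrite ler_pdivlMr ?mulr_gt0 ?ltr0n // mulrC.
have hd12 : `|delta| <= 1 / 12.
  apply: le_trans hd _; rewrite !div1r lef_pV2 ?posrE ?mulr_gt0 ?ltr0n //.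
  by rewrite ler_peMr.
have delta1 : 0 < 1 + delta by move: hd12; clear; rewrite ler_norml; lra.
have cl1 := cardgt0 _ (ltW (mulr_gt0 delta1 rho0)).
rewrite -!/(card _).
have [dpos|dneg] := leP 0 delta.
- rewrite ger0_norm //; rewrite ger0_norm // in hd12 hdy.
  have p0 : 0 < 1 + 12 * d%:R * delta by rewrite ltr_pwDl // !mulr_ge0.
  apply/andP; split.
    rewrite ler_pdivlMr //; apply: (@le_trans _ _ (1 * card rho)).
      by apply: ler_wpM2r; [exact: ltW | rewrite gerBl !mulr_ge0].
    by rewrite mul1r ler_nat Bohr_leq_card // ler_peMl ?(ltW rho0) // lerDl.
  rewrite ler_pdivrMr // -ler_ln ?posrE ?mulr_gt0 // lnM ?posrE // -lerBlDr.
  apply: le_trans (hup _ _) (ln1D_le_regular dpos hdy).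
  by rewrite dpos hd12.
- rewrite ltr0_norm //; rewrite ltr0_norm // in hd12 hdy.
  have dN : 0 <= - delta by rewrite oppr_ge0 ltW.
  apply/andP; split; last first.
    rewrite ler_pdivrMr //; apply: (@le_trans _ _ (1 * card rho)).
      by rewrite mul1r ler_nat Bohr_leq_card // ler_piMl ?(ltW rho0) // gerDl ltW.
    by apply: ler_wpM2r; [exact: ltW | rewrite lerDl !mulr_ge0].
  rewrite ler_pdivlMr //.
  apply: (@le_trans _ _ ((1 + delta) ^+ (7 * d) * card rho)).
    apply: ler_wpM2r; first exact: ltW.
    have := @bernoulli_le (- delta) (7 * d); rewrite opprK => h1.
    apply: le_trans (h1 _); last by move: dN hd12; clear; lra.
    rewrite natrM lerD2l lerN2; apply: ler_wpM2r => //; apply: ler_wpM2r => //.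
    by clear; lra.
  rewrite -ler_ln ?posrE ?mulr_gt0 ?exprn_gt0 // lnM ?posrE ?exprn_gt0 // lnXn //.
  have -> : ln (1 + delta) *+ (7 * d) = 7 * d%:R * ln (1 + delta).
    by rewrite -[LHS]mulr_natl natrM.
  have := hdown delta; rewrite (ltW dneg) lerNl hd12 => /(_ isT).
  by rewrite lerNr opprB lerBrDr.
Qed.

(* The slope [7 d] is admissible since [(1 + t) ^ (7 d) <= 1 + 12 d t] for
   [12 d t <= 1], and large enough since [1024 ^ 2 < 8 ^ 7]: over the range
   [[rho / 8, rho]] the growth of Bohr sets is below half that slope. *)
Lemma regular_radius Gamma rho : (0 < #|Gamma|)%N -> 0 <= rho ->
  exists rho', rho / 8 <= rho' <= rho /\ regular_Bohr Gamma rho'.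
Proof.
move=> hG; rewrite le_eqVlt => /orP[/eqP<-|r0].
  exists 0; split; first by rewrite mul0r lexx.
  move=> delta _; rewrite mulr0 divff ?pnatr_eq0 -?lt0n ?Bohr_card_gt0 //.
  by rewrite lerDl gerBl !mulr_ge0.
set d := #|Gamma| in hG.
pose card (t : R) : R := #|Bohr Gamma t|%:R.
have card0 t : 0 <= t -> 0 < card t by move=> h; rewrite ltr0n Bohr_card_gt0.
pose a t := ln (card (expR t)).
pose c : R := 7 * d%:R.
have d1 : 1 <= d%:R :> R by rewrite ler1n.
have ln2 : 0 < ln 2 :> R by rewrite ln_gt0 // ltr1n.
(* All points where [a] can jump. A vanishing distance only contributes a spurious point, which is
   harmless. *)
pose V := [seq ln (normc (chi R p.1 p.2 - 1)) | p : G * G].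
have ln8 : ln (rho / 8) = ln rho - 3 * ln 2.
  rewrite ln_div ?posrE // (_ : 8 = 2 ^+ 3); last by rewrite -natrX.
  by rewrite lnXn // mulr_natl.
(* The bounds [A] and [B] are taken at radii 11/12 below and 13/12 above the range: the two level
   bounds on [s] then control the dilates that leave the range. *)
have [|||||||s [/andP[s1 s2] s3 s4 s5 s6]] := @rising_sun _ a c (ln (rho / 8)) (ln rho)
   (ln (card (rho / 8 * (11 / 12)))) (ln (card (rho * (13 / 12)))) V.
- by rewrite /c; lra.
- by rewrite ln8; lra.
- by move=> t u tu; apply: ln_Bohr_le; rewrite ?expR_ge0 // ler_expR.
- move=> t u /andP[_ tu] _ hV; rewrite /a /card; congr (ln _%:R).
  apply: eq_card => x; apply/mem_Bohr/mem_Bohr => h r rG; last first.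
    by apply: le_trans (h r rG) _; rewrite ler_expR.
  rewrite leNgt; apply/negP => h1; have w0 := lt_trans (expR_gt0 t) h1.
  have := hV (ln (normc (chi R r x - 1))); rewrite (_ : _ \in V); last first.
    by apply/mapP; exists (r, x); rewrite ?mem_enum.
  move=> /(_ isT) /negP; apply; rewrite -ltr_expR -(ler_expR _ u) lnK ?posrE //.
  by rewrite h1 h.
- rewrite /a lnK ?posrE ?divr_gt0 //; apply: ln_Bohr_le; last by lra.
  by rewrite !mulr_ge0 // ltW.
- by rewrite /a lnK ?posrE //; apply: ln_Bohr_le; lra.
(* The ratio of the two radii is 104/11, below 10, so a single growth step covers the range with its
   margins. *)
- have h10 : card (rho * (13 / 12)) <= 2 ^+ 10 ^+ d * card (rho / 8 * (11 / 12)).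
    have := @Bohr_growth R n Gamma (rho * (13 / 12)); rewrite mulr_gt0 // => /(_ isT) h.
    rewrite -exprM /card -natrX -[leRHS](natrM R) ler_nat expnM.
    apply: leq_trans h _; rewrite leq_mul2l; apply/orP; right.
    by apply: Bohr_leq_card; lra.
  have hc t : 0 < t -> 0 < card t by move=> t0; rewrite card0 // ltW.
  have p1 : 0 < card (rho / 8 * (11 / 12)) by rewrite hc // !mulr_gt0.
  have p2 : 0 < card (rho * (13 / 12)) by rewrite hc // !mulr_gt0.
  move: h10; rewrite -ler_ln ?posrE // ?mulr_gt0 ?exprn_gt0 //.
  rewrite lnM ?posrE ?exprn_gt0 // -exprM lnXn // ln8 /c => h.
  have : ln (2 : R) *+ (10 * d) = 10 * d%:R * ln 2.
    by rewrite -[LHS]mulr_natl natrM.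
  by have := mulr_gt0 (lt_le_trans ltr01 d1) ln2; nra.
set lam := expR s; have lam0 : 0 < lam by apply: expR_gt0.
have es : ln lam = s by rewrite expRK.
have lam1 : rho / 8 <= lam by rewrite -ler_ln ?posrE ?es // divr_gt0.
have lam2 : lam <= rho by rewrite -ler_ln ?posrE // es ltW.
exists lam; split; first by rewrite lam1 lam2.
have lnl delta : -1 < delta -> ln ((1 + delta) * lam) = ln (1 + delta) + s.
  by move=> h; rewrite lnM ?posrE ?es // -ltrBlDl sub0r.
have aE t : 0 < t -> a (ln t) = ln (card t) by move=> t0; rewrite /a lnK.
have c0 : 0 < c by rewrite mulr_gt0 // (lt_le_trans ltr01).
apply: regular_of_ln_card => // delta /andP[h1 h2]; rewrite -/(card _) -/(card _).
- have hd : -1 < delta by apply: lt_le_trans h1; clear; lra.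
  have p0 : 0 < (1 + delta) * lam by rewrite mulr_gt0 // -ltrBlDl sub0r.
  rewrite -/(a s) -aE // lnl //; set t := ln (1 + delta) + s.
  have ln0 : 0 <= ln (1 + delta) by rewrite ln_ge0 // lerDl.
  have -> : 7 * #|Gamma|%:R * ln (1 + delta) = c * (t - s) by rewrite /t addrK.
  have [tr|tr] := leP t (ln rho); first by apply: s4; rewrite tr lerDr ln0.
  have k1 : a t <= ln (card (rho * (13 / 12))).
    rewrite /t -lnl // aE //; apply: ln_Bohr_le; first exact: ltW.
    by rewrite mulrC; apply: ler_pM; rewrite ?(ltW lam0) //; move: h2 hd; clear; lra.
  have k2 : c * ln rho <= c * t by rewrite ler_pM2l // ltW.
  by move: s6 k1 k2; clear; lra.
- have hd : -1 < delta by apply: lt_le_trans h1; clear; lra.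
  have p0 : 0 < (1 + delta) * lam by rewrite mulr_gt0 // -ltrBlDl sub0r.
  rewrite -/(a s) -aE // lnl //; set t := ln (1 + delta) + s.
  have ln0 : ln (1 + delta) <= 0 by rewrite ln_le0 // gerDl.
  have -> : - (7 * #|Gamma|%:R * ln (1 + delta)) = c * (s - t).
    by rewrite /t opprD addrCA subrr addr0 mulrN.
  have [tr|tr] := leP (ln (rho / 8)) t; first by apply: s3; rewrite tr /= gerDr ln0.
  have k1 : ln (card (rho / 8 * (11 / 12))) <= a t.
    rewrite /t -lnl // aE //; apply: ln_Bohr_le; first by rewrite !mulr_ge0 // ltW.
    rewrite mulrC; apply: ler_pM; rewrite ?divr_ge0 ?(ltW r0) //.
    by move: h1; clear; lra.
  have k2 : c * t <= c * ln (rho / 8) by rewrite ler_pM2l // ltW.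
  by move: s5 k1 k2; clear; lra.
Qed.

End RegularRadius.

(** * Almost periodicity *)

Section Expect.
Variables (R : realType) (T : finType).
Implicit Types (A : {set T}) (f g : T -> R).

Lemma card_neq0 A : A != finset.set0 -> 0 < #|A|%:R :> R.
Proof. by rewrite ltr0n card_gt0. Qed.

Lemma sum_expect A f : A != finset.set0 -> \sum_(x in A) f x = #|A|%:R * expect A f.
Proof. by move=> /card_neq0 h; rewrite /expect mulrA divff ?mul1r // gt_eqF. Qed.

Lemma ler_expect A f g : (forall x, x \in A -> f x <= g x) -> expect A f <= expect A g.
Proof. by move=> h; rewrite ler_wpM2l ?invr_ge0 //; apply: ler_sum. Qed.

Lemma expect_const A (c : R) : A != finset.set0 -> expect A (fun=> c) = c.
Proof.
move=> /card_neq0 h; rewrite /expect sumr_const -[c *+ _]mulr_natl mulrA mulVf ?mul1r //.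
by rewrite gt_eqF.
Qed.

Lemma ler_norm_expect A f (c : R) : A != finset.set0 ->
  (forall x, x \in A -> `|f x| <= c) -> `|expect A f| <= c.
Proof.
move=> A0 h; rewrite -[leRHS](expect_const c A0) normrM ger0_norm ?invr_ge0 //.
rewrite ler_wpM2l ?invr_ge0 //; apply: le_trans (ler_norm_sum _ _ _) _.
exact: ler_sum.
Qed.

Lemma expectB A f g : expect A f - expect A g = expect A (fun x => f x - g x).
Proof. by rewrite /expect -mulrBr sumrB. Qed.

(** Average the tangent of [expR] at the mean. *)
Lemma jensen_expR A f : A != finset.set0 ->
  expR (expect A f) <= expect A (fun x => expR (f x)).
Proof.
move=> A0; set c := expect A f.
apply: (@le_trans _ _ (expect A (fun x => expR c * (1 + (f x - c))))).
  rewrite /expect -mulr_sumr big_split sumrB /= !sumr_const sum_expect // -/c.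
  by rewrite mulr_natl subrr addr0 mulrCA mulVf ?mulr1 // gt_eqF // card_neq0.
apply: ler_expect => x _.
by rewrite -[in leRHS](subrK c (f x)) expRD mulrC ler_wpM2r ?expR_ge0 // expR_ge1Dx.
Qed.

End Expect.

(** * Exponential moments of an indicator *)

Section Sampling.
Variable R : realType.

Lemma expR_le_quadratic (v : R) : v <= 2^-1 -> expR v <= 1 + v + 2 * v ^+ 2.
Proof.
move=> hv; have v1 : 0 < 1 - v by lra.
apply: le_trans (expR_le_inv _) _; first by lra.
rewrite -div1r ler_pdivrMr //.
have : 0 <= v ^+ 2 * (1 - 2 * v) by rewrite mulr_ge0 ?sqr_ge0 //; lra.
by lra.
Qed.

(** Convexity in [mu]: the power lies below its chord over [[0, 1]]. With [mu] a density, the factor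
    pulled out this way sums over the group to [#|D|], not to the order of the group. *)
Lemma expX_le_chord (a mu : R) m : 0 <= a -> 0 <= mu <= 1 ->
  (1 + a * mu) ^+ m <= 1 + mu * ((1 + a) ^+ m - 1).
Proof.
move=> a0 /andP[m0 m1]; elim: m => [|m IH]; first by rewrite !expr0 subrr mulr0 addr0.
set c := (1 + a) ^+ m in IH.
have c1 : 0 <= c - 1 by rewrite subr_ge0 exprn_ege1 // lerDl.
rewrite !exprS -/c; have am : 0 <= 1 + a * mu by rewrite addr_ge0 // mulr_ge0.
apply: le_trans (ler_wpM2l am IH) _.
have : 0 <= a * mu * (c - 1) * (1 - mu) by rewrite !mulr_ge0 // subr_ge0.
by lra.
Qed.

(** The variance of an indicator is at most its mean, so the quadratic term keeps a factor [mu]. *)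
Lemma mgf_indicator (T : finType) (Z A : {set T}) (u : R) : Z != finset.set0 ->
  `|u| <= 2^-1 -> let mu := expect Z (ind R A) in
  \sum_(z in Z) expR (u * (ind R A z - mu)) <= #|Z|%:R * (1 + 2 * u ^+ 2 * mu).
Proof.
move=> Z0 hu; cbv zeta; set mu := expect Z _; rewrite sum_expect // ler_wpM2l //.
have ind01 z : 0 <= ind R A z <= 1 by rewrite /ind; case: (z \in A); rewrite ?lexx ?ler01.
have mu01 : 0 <= mu <= 1.
  rewrite -[0 in X in X && _](expect_const (0 : R) Z0).
  rewrite -[1 in X in _ && X](expect_const (1 : R) Z0).
  by rewrite !ler_expect // => z _; have /andP[] := ind01 z.
apply: (@le_trans _ _ (expect Z (fun z => 1 + u * (ind R A z - mu) +
    2 * u ^+ 2 * ((1 - 2 * mu) * ind R A z + mu ^+ 2)))).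
  apply: ler_expect => z _; apply: le_trans (expR_le_quadratic _) _.
    move: hu (ind01 z) mu01; rewrite ler_norml => /andP[h1 h2] /andP[h3 h4] /andP[h5 h6].
    have : `|u * (ind R A z - mu)| <= 2^-1 * 1.
      by rewrite normrM ler_pM // ler_norml; lra.
    by move=> /(le_trans (ler_norm _)); rewrite mulr1.
  rewrite lerD2l exprMn mulrA; apply: ler_wpM2l; first by rewrite mulr_ge0 ?sqr_ge0.
  by rewrite /ind; case: (z \in A) => /=; lra.
have lin (a b : R) : expect Z (fun z => a + b * ind R A z) = a + b * mu.
  rewrite /expect big_split /= mulrDr -mulr_sumr mulrCA -/(expect Z _) -/mu.
  by congr (_ + _); rewrite -[RHS](expect_const _ Z0).
have -> : (fun z => 1 + u * (ind R A z - mu) + 2 * u ^+ 2 * ((1 - 2 * mu) * ind R A z + mu ^+ 2))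
  = (fun z => (1 - u * mu + 2 * u ^+ 2 * mu ^+ 2) +
       (u + 2 * u ^+ 2 * (1 - 2 * mu)) * ind R A z).
  by apply/funext => z; ring.
rewrite lin; have : 0 <= 2 * (u ^+ 2 * mu ^+ 2) by rewrite mulr_ge0 // mulr_ge0 ?sqr_ge0.
by lra.
Qed.

End Sampling.

(** * Random sampling and almost periods *)

Section CrootSisask.
Variables (R : realType) (G : finZmodType).
Implicit Types (D Y Z S W : {set G}) (u : R) (x y z w t : G).

Lemma ind_ge0 (T : finType) (A : {set T}) a : 0 <= ind R A a.
Proof. by rewrite /ind; case: (a \in A). Qed.

Lemma ind_le1 (T : finType) (A : {set T}) a : ind R A a <= 1.
Proof. by rewrite /ind; case: (a \in A); rewrite ?ler01. Qed.

Definition density D Z x : R := expect Z (fun z => ind R D (x + z)).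

Definition deviation D Z m (om : {ffun 'I_m -> G}) x : R :=
  \sum_i (ind R D (x + om i) - density D Z x).

(** Subtracting 2 makes every term nonnegative, and zero at zero deviation: the sum may be
    restricted to a translate of [- Y], and its mean is controlled by [#|D|] although [x] runs over
    the whole group. *)
Definition cosh_dev D Z m u om : R :=
  \sum_x (expR (u * @deviation D Z m om x) + expR (- u * deviation D Z om x) - 2).

Definition tuples m Z : {set {ffun 'I_m -> G}} := [set om : {ffun 'I_m -> G} | [forall i, om i \in Z]].

Lemma card_tuples m Z : #|tuples m Z| = (#|Z| ^ m)%N.
Proof.
rewrite -[m in RHS]card_ord -card_ffun_on; apply: eq_card => om.
by rewrite inE; apply/forallP/ffun_onP.
Qed.

Lemma cosh_ge2 (v : R) : 2 <= expR v + expR (- v).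
Proof. by have := expR_ge1Dx v; have := expR_ge1Dx (- v); lra. Qed.

Lemma density_itv D Z x : Z != finset.set0 -> 0 <= density D Z x <= 1.
Proof.
move=> Z0; rewrite -[0 in X in X && _](expect_const (0 : R) Z0).
rewrite -[1 in X in _ && X](expect_const (1 : R) Z0).
by rewrite !ler_expect // => z _; rewrite ?ind_ge0 ?ind_le1.
Qed.

Lemma sum_ind D : \sum_x ind R D x = #|D|%:R.
Proof.
by rewrite -sum1_card natr_sum [RHS]big_mkcond; apply: eq_bigr => x _; rewrite /ind; case: ifP.
Qed.

Lemma sum_density D Z : Z != finset.set0 -> \sum_x density D Z x = #|D|%:R.
Proof.
move=> Z0; rewrite /density /expect -mulr_sumr exchange_big /=.
rewrite -[RHS](expect_const _ Z0) /expect; congr (_ * _); apply: eq_bigr => z _.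
by rewrite (reindex_inj (addIr (- z))) /= -sum_ind; apply: eq_bigr => x _; rewrite subrK.
Qed.

(** The coordinates of a tuple vary independently, so the exponential moment factors as an [m]-th
    power. *)
Lemma sum_expR_deviation D Z m u x : Z != finset.set0 -> `|u| <= 2^-1 ->
  \sum_(om in tuples m Z) expR (u * deviation D Z om x)
  <= #|Z|%:R ^+ m * (1 + density D Z x * (expR (2 * u ^+ 2 * m%:R) - 1)).
Proof.
move=> Z0 hu; set mu := density D Z x.
have -> : \sum_(om in tuples m Z) expR (u * deviation D Z om x) =
    (\sum_(z in Z) expR (u * (ind R D (x + z) - mu))) ^+ m.
  rewrite -[m in RHS]card_ord -prodr_const bigA_distr_big_dep /=.
  apply: eq_big => [om|om _].
    by rewrite inE; apply/forallP/familyP.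
  by rewrite /deviation mulr_sumr expR_sum.
have /andP[mu0 mu1] := @density_itv D Z x Z0.
pose A := [set z | x + z \in D].
have indA z : ind R A z = ind R D (x + z) by rewrite /ind inE.
have muA : expect Z (ind R A) = mu by apply: congr1; apply/funext => z; rewrite indA.
have := @mgf_indicator R G Z A u Z0 hu; cbv zeta; rewrite muA => h.
have e0 : 0 <= \sum_(z in Z) expR (u * (ind R D (x + z) - mu)).
  by apply: sumr_ge0 => z _; apply: expR_ge0.
have u0 : 0 <= 2 * u ^+ 2 by rewrite mulr_ge0 ?sqr_ge0.
apply: (@le_trans _ _ ((#|Z|%:R * (1 + 2 * u ^+ 2 * mu)) ^+ m)).
  rewrite lerXn2r ?nnegrE //; first by rewrite mulr_ge0 // addr_ge0 // mulr_ge0.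
  by under eq_bigr do rewrite -indA.
rewrite exprMn ler_wpM2l ?exprn_ge0 //.
apply: le_trans (expX_le_chord m u0 _) _; first by rewrite mu0.
rewrite lerD2l ler_wpM2l // lerB // -[2 * u ^+ 2 * m%:R]mulrC expRM_natl.
by rewrite lerXn2r ?nnegrE ?expR_ge0 ?expR_ge1Dx // addr_ge0.
Qed.

Lemma sum_cosh_dev D Z m u : Z != finset.set0 -> `|u| <= 2^-1 ->
  \sum_(om in tuples m Z) cosh_dev D Z u om
  <= 2 * (#|Z| ^ m)%N%:R * #|D|%:R * expR (2 * u ^+ 2 * m%:R).
Proof.
move=> Z0 hu; rewrite /cosh_dev exchange_big /=; set E := expR _.
apply: (@le_trans _ _ (\sum_x (2 * (#|Z| ^ m)%N%:R * E) * density D Z x)); last first.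
  by rewrite -mulr_sumr sum_density // mulrAC.
apply: ler_sum => x _; rewrite !big_split /= sumr_const card_tuples.
have h1 := sum_expR_deviation D m x Z0 hu.
have h2 := @sum_expR_deviation D Z m (- u) x Z0; rewrite normrN sqrrN in h2.
have := lerD h1 (h2 hu) => h; rewrite -natrX in h.
have -> : - 2 *+ #|Z| ^ m = - (2 * (#|Z| ^ m)%N%:R) :> R by rewrite mulNrn mulr_natr.
have /andP[mu0 _] := @density_itv D Z x Z0.
have : 0 <= (#|Z| ^ m)%N%:R * density D Z x by rewrite mulr_ge0.
by move: h; rewrite -/E; lra.
Qed.

Definition good_tuples D Z m u : {set {ffun 'I_m -> G}} :=
  [set om in tuples m Z |
    cosh_dev D Z u om <= 4 * #|D|%:R * expR (2 * u ^+ 2 * m%:R)].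

(** Markov's inequality: the threshold in [good_tuples] is twice the bound on the mean, so at least
    half of the tuples pass. *)
Lemma card_good_tuples D Z m u : Z != finset.set0 -> D != finset.set0 ->
  `|u| <= 2^-1 -> (#|Z| ^ m <= 2 * #|good_tuples D Z m u|)%N.
Proof.
move=> Z0 D0 hu; set E := expR (2 * u ^+ 2 * m%:R).
pose c := 4 * #|D|%:R * E.
have c0 : 0 < c by rewrite !mulr_gt0 ?expR_gt0 ?card_neq0.
have hdev om : 0 <= cosh_dev D Z u om.
  by apply: sumr_ge0 => x _; rewrite mulNr subr_ge0 cosh_ge2.
have hbad : #|tuples m Z :\: good_tuples D Z m u|%:R * c <=
    \sum_(om in tuples m Z) cosh_dev D Z u om.
  rewrite mulr_natl -sumr_const [leRHS](big_setID (tuples m Z :\: good_tuples D Z m u)) /=.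
  rewrite (finset.setIidPr (finset.subsetDl _ _)).
  apply: ler_wpDr; first by apply: sumr_ge0.
  apply: ler_sum => om /finset.setDP[omT].
  by rewrite inE omT /= -ltNge => /ltW.
have hc := cardsID (good_tuples D Z m u) (tuples m Z).
rewrite (finset.setIidPr _) ?card_tuples in hc; last first.
  by apply/fintype.subsetP => om; rewrite inE => /andP[].
have := le_trans hbad (sum_cosh_dev D m Z0 hu).
have -> : 2 * (#|Z| ^ m)%N%:R * #|D|%:R * E = 2^-1 * (#|Z| ^ m)%N%:R * c.
  by rewrite /c; field.
rewrite ler_pM2r // => h.
rewrite -(ler_nat R) -hc natrD natrM; move: h; rewrite -hc natrD.
by lra.
Qed.

(** Jensen over [Y], at [u] and at [- u]. With [q = #|D| / #|Y| >= 1], the exponential mean is at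
    most [2 + 4 * (q * E) <= 6 * (q * E)], whence the constant 6. *)
Lemma sum_deviation_le D Z Y m u om w : Y != finset.set0 -> (#|Y| <= #|D|)%N -> 0 < u ->
  cosh_dev D Z u om <= 4 * #|D|%:R * expR (2 * u ^+ 2 * m%:R) ->
  `|expect Y (fun y => @deviation D Z m om (w - y))|
   <= ln (6 * (#|D|%:R / #|Y|%:R)) / u + 2 * u * m%:R.
Proof.
move=> Y0 YD u0; set E := expR _ => hdev.
have y0 : 0 < #|Y|%:R :> R by apply: card_neq0.
have E1 : 1 <= E by rewrite -expR0 ler_expR !mulr_ge0 // ltW.
have DY1 : 1 <= #|D|%:R / #|Y|%:R :> R by rewrite ler_pdivlMr // mul1r ler_nat.
set q := #|D|%:R / #|Y|%:R in DY1 *.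
have q0 : 0 < q by apply: lt_le_trans DY1.
have q6 : 0 < 6 * q by rewrite (mulr_gt0 _ q0).
have key v : `|v| = u -> expect Y (fun y => v * deviation D Z om (w - y)) <=
    ln (6 * q) + 2 * u ^+ 2 * m%:R.
  move=> hv; rewrite -[2 * _ * _]expRK -/E -lnM ?posrE ?expR_gt0 //.
  rewrite -ler_expR lnK; last by rewrite posrE (mulr_gt0 q6) ?expR_gt0.
  apply: le_trans (jensen_expR _ Y0) _.
  apply: (@le_trans _ _ (expect Y (fun y => 2 + (expR (u * deviation D Z om (w - y)) +
     expR (- u * deviation D Z om (w - y)) - 2)))).
    apply: ler_expect => y _; rewrite [leRHS]addrC subrK.
    have [->|->] : v = u \/ v = - u.
      case: (leP 0 v) hv => v0; first by rewrite ger0_norm //; left.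
      by rewrite ltr0_norm // => <-; right; rewrite opprK.
    - by rewrite lerDl expR_ge0.
    - by rewrite lerDr expR_ge0.
  have h : \sum_(y in Y) (expR (u * deviation D Z om (w - y)) +
     expR (- u * deviation D Z om (w - y)) - 2) <= 4 * #|D|%:R * E.
    apply: le_trans hdev; rewrite /cosh_dev.
    rewrite [leRHS](reindex_inj (inj_comp (addrI w) oppr_inj)) /=.
    rewrite big_mkcond /=; apply: ler_sum => y _; case: ifP => // _.
    by rewrite mulNr subr_ge0 cosh_ge2.
  rewrite /expect big_split /= mulrDr -[X in X + _]/(expect Y (fun=> 2)) expect_const //.
  have yV : 0 <= #|Y|%:R^-1 :> R by rewrite invr_ge0.
  have := ler_wpM2l yV h.
  have -> : #|Y|%:R^-1 * (4 * #|D|%:R * E) = 4 * (q * E).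
    by rewrite /q; field; rewrite gt_eqF.
  have : 1 <= q * E by apply: mulr_ege1.
  by lra.
have scale c : expect Y (fun y => c * deviation D Z om (w - y)) =
    c * expect Y (fun y => deviation D Z om (w - y)).
  by rewrite /expect -mulr_sumr mulrCA.
have k1 := key u (gtr0_norm u0).
have k2 := key (- u) (etrans (normrN u) (gtr0_norm u0)).
rewrite !scale in k1 k2; set X := expect _ _ in k1 k2 *.
have -> : ln (6 * q) / u + 2 * u * m%:R = (ln (6 * q) + 2 * u ^+ 2 * m%:R) / u.
  by field; rewrite gt_eqF.
by rewrite ler_norml -mulNr ler_pdivrMr // ler_pdivlMr // !(mulrC X); apply/andP; split; lra.
Qed.

Definition corr D Y Z w : R := \sum_(y in Y) \sum_(z in Z) ind R D (z - y + w).

Definition sample_corr D Y m (v : {ffun 'I_m -> G}) w : R :=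
  \sum_(y in Y) \sum_i ind R D (v i - y + w).

Lemma sample_corr_close D Y Z m u om w : (0 < m)%N ->
  Y != finset.set0 -> Z != finset.set0 -> (#|Y| <= #|D|)%N -> 0 < u ->
  om \in @good_tuples D Z m u ->
  `|sample_corr D Y om w / m%:R - corr D Y Z w / #|Z|%:R|
    <= #|Y|%:R * (ln (6 * (#|D|%:R / #|Y|%:R)) / (u * m%:R) + 2 * u).
Proof.
move=> m0 Y0 Z0 YD u0; rewrite inE => /andP[_ hom].
have := @sum_deviation_le D Z Y m u om w Y0 YD u0 hom.
have y0 := card_neq0 R Y0; have z0 := card_neq0 R Z0.
have mR : 0 < m%:R :> R by rewrite ltr0n.
have -> : expect Y (fun y => deviation D Z om (w - y)) =
    #|Y|%:R^-1 * (m%:R * (sample_corr D Y om w / m%:R - corr D Y Z w / #|Z|%:R)).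
  congr (_ * _); rewrite mulrBr [m%:R * (sample_corr _ _ _ _ / _)]mulrC divfK ?gt_eqF //.
  rewrite /sample_corr /corr mulr_suml mulr_sumr -sumrB; apply: eq_bigr => y _.
  rewrite /deviation sumrB sumr_const card_ord -[X in _ - X]mulr_natl; congr (_ - _).
    by apply: eq_bigr => i _; congr (ind R D _); rewrite addrC addrA addrAC.
  congr (_ * _); rewrite /density /expect mulrC; congr (_ * _).
  by apply: eq_bigr => z _; congr (ind R D _); rewrite addrC addrA addrAC.
rewrite normrM ger0_norm ?invr_ge0 // normrM ger0_norm //.
set X := `| _ |; set l := ln _ => h.
have -> : l / (u * m%:R) + 2 * u = (l / u + 2 * u * m%:R) / m%:R.
  by field; rewrite !gt_eqF.
rewrite mulrA ler_pdivlMr // -ler_pdivrMl //.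
by rewrite (mulrC X).
Qed.

(* Croot-Sisask almost periodicity. The usual L^p norm, with p about
   [ln (#|D| / #|Y|)], is replaced by the exponential moment [cosh_dev]. *)
Lemma croot_sisask D Y Z S W m (eta : R) : (0 < m)%N ->
  Y != finset.set0 -> Z != finset.set0 -> S != finset.set0 -> (#|Y| <= #|D|)%N ->
  (forall z s, z \in Z -> s \in S -> z + s \in W) ->
  0 < eta <= 1 -> 8 * ln (6 * (#|D|%:R / #|Y|%:R)) <= eta ^+ 2 * m%:R ->
  exists T : {set G}, [/\ T \subset S,
    (#|S| * #|Z| ^ m <= 2 * (#|T| * #|W| ^ m))%N &
    forall w t t', t \in T -> t' \in T ->
      `|corr D Y Z (w + t) - corr D Y Z (w + t')| <= 2 * eta * #|Y|%:R * #|Z|%:R].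
Proof.
move=> m0 Y0 Z0 S0 YD hW /andP[eta0 eta1] hm.
have D0 : D != finset.set0 by rewrite -card_gt0 (leq_trans _ YD) // card_gt0.
(* With this [u] each of the two terms of the sampling error is at most [eta / 2]. *)
pose u := eta / 4; have u0 : 0 < u by rewrite divr_gt0.
have hu : `|u| <= 2^-1 by rewrite gtr0_norm // /u; move: eta1; clear; lra.
set A := good_tuples D Z m u.
pose shift (v : {ffun 'I_m -> G}) t : {ffun 'I_m -> G} := [ffun i => v i - t].
(* The shifts that turn [v] into a good sample. Each [t] in [S] and each good [om] yield the tuple
   [v = om + t] in [W]; averaging over such [v] gives one with many shifts. *)
pose F v := [set t in S | shift v t \in A].
have hsum : (#|S| * #|A| <= \sum_(v in tuples m W) #|F v|)%N.
  under eq_bigr do rewrite -sum1dep_card big_mkcondr /=.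
  rewrite exchange_big /= -sum_nat_const; apply: leq_sum => t tS.
  rewrite -big_mkcondr /= sum1dep_card.
  have inj : injective (fun v : {ffun 'I_m -> G} => shift v (- t)).
    move=> v v' /ffunP h; apply/ffunP => i; have := h i; rewrite !ffunE.
    exact: addIr.
  rewrite -(card_imset A inj); apply/subset_leq_card/fintype.subsetP => v /imsetP[om omA ->].
  rewrite inE; apply/andP; split.
    rewrite inE; apply/forallP => i; rewrite ffunE opprK hW //.
    by move: omA; rewrite !inE => /andP[/forallP/(_ i)].
  rewrite (_ : shift _ _ = om) //; apply/ffunP => i; rewrite !ffunE opprK.
  by rewrite addrK.
have [v hv] : exists v, (#|S| * #|A| <= #|F v| * #|W| ^ m)%N.
  apply: contrapT => hno.
  have W0 : (0 < #|W|)%N.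
    have [z zZ] := set0Pn _ Z0; have [s sS] := set0Pn _ S0.
    by apply/card_gt0P; exists (z + s); apply: hW.
  have : (\sum_(v in tuples m W) (#|F v| * #|W| ^ m).+1 <= \sum_(v in tuples m W) #|S| * #|A|)%N.
    by apply: leq_sum => v _; rewrite ltnNge; apply/negP => h; apply: hno; exists v.
  under eq_bigr do rewrite -addn1.
  rewrite big_split /= -big_distrl /= !sum_nat_const muln1 card_tuples.
  have : (0 < #|W| ^ m)%N by rewrite expn_gt0 W0.
  move: hsum; set a := (\sum_(_ in _) _)%N; set b := (#|S| * #|A|)%N.
  set w := (#|W| ^ m)%N; move=> h1 h2 h3; have : (w * b <= w * a)%N by rewrite leq_mul.
  by rewrite (mulnC w a); lia.
exists (F v); split.
- by apply/fintype.subsetP => t; rewrite inE => /andP[].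
- have := card_good_tuples m Z0 D0 hu; rewrite -/A => hA.
  rewrite mulnC; apply: leq_trans (leq_mul hA (leqnn _)) _.
  by rewrite -mulnA leq_mul2l mulnC hv orbT.
have hl : ln (6 * (#|D|%:R / #|Y|%:R)) / (u * m%:R) + 2 * u <= eta.
  have mR : 0 < m%:R :> R by rewrite ltr0n.
  have -> : 2 * u = eta / 2 by rewrite /u; field.
  rewrite -lerBrDr ler_pdivrMr ?mulr_gt0 // /u.
  by move: hm; set l := ln _; clear; lra.
(* The sample [v - t] at [w + t] is the sample [v] at [w], so all [t] in [F v] are compared with one
   and the same quantity. *)
have close w t : t \in F v ->
    `|sample_corr D Y v w / m%:R - corr D Y Z (w + t) / #|Z|%:R| <= #|Y|%:R * eta.
  rewrite inE => /andP[_ tA].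
  have -> : sample_corr D Y v w = sample_corr D Y (shift v t) (w + t).
    apply: eq_bigr => y _; apply: eq_bigr => i _; rewrite ffunE; congr (ind R D _).
    by rewrite [w + t]addrC addrA -[v i - t - y]addrAC subrK.
  apply: le_trans (sample_corr_close (w + t) m0 Y0 Z0 YD u0 tA) _.
  by rewrite ler_wpM2l.
move=> w t t' /(close w) h /(close w) h'.
have z0 := card_neq0 R Z0.
have : `|corr D Y Z (w + t) / #|Z|%:R - corr D Y Z (w + t') / #|Z|%:R| <= 2 * eta * #|Y|%:R.
  by move: h h'; clear; rewrite !ler_norml; move=> /andP[? ?] /andP[? ?]; lra.
by rewrite -mulrBl normrM [`| _^-1|]ger0_norm ?invr_ge0 // ler_pdivrMr.
Qed.

End CrootSisask.

(** * Chang's theorem relative to a Bohr set *)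

Section Chang.
Variables (R : realType) (n : nat).
Local Notation G := 'I_n.+1.
Local Notation chi := (chi R).
Implicit Types (X T S : {set G}) (f w : G -> R) (x y r s t l : G) (Lam : seq G).

Definition avgs X f x : R := expect X (fun s => f (x + s)).

Lemma avgs_ge0 X f k : (forall x, 0 <= f x) -> forall x, 0 <= iter k (avgs X) f x.
Proof.
move=> f0; elim: k => //= k IH x; rewrite /avgs /expect mulr_ge0 ?invr_ge0 //.
by apply: sumr_ge0 => s _; apply: IH.
Qed.

Lemma sum_iter_avgs X f k : X != finset.set0 -> \sum_x iter k (avgs X) f x = \sum_x f x.
Proof.
move=> X0; elim: k => //= k <-; rewrite /avgs /expect -mulr_sumr exchange_big /=.
rewrite -[RHS](expect_const _ X0) /expect; congr (_ * _); apply: eq_bigr => s _.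
by rewrite [RHS](reindex_inj (addIr s)).
Qed.

Definition hat f r : R[i] := \sum_x (f x)%:C%C * chi r x.

Lemma hat_avgs X f r : X != finset.set0 ->
  normc (hat (avgs X f) r) = normc (\sum_(s in X) chi r s) / #|X|%:R * normc (hat f r).
Proof.
move=> X0.
have -> : hat (avgs X f) r = (#|X|%:R^-1)%:C%C * ((\sum_(s in X) chi r s)^*%C * hat f r).
  rewrite /hat /avgs /expect.
  under eq_bigr do rewrite rmorphM -mulrA rmorph_sum mulr_suml.
  rewrite -mulr_sumr exchange_big /=; congr (_ * _).
  rewrite rmorph_sum mulr_suml; apply: eq_bigr => s _.
  rewrite mulr_sumr (reindex_inj (addIr (- s))) /=.
  by apply: eq_bigr => x _; rewrite subrK chiD chiN mulrA mulrC.
by rewrite !normcM normc_real normc_conj ger0_norm ?invr_ge0 // mulrA [_^-1 * _]mulrC.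
Qed.

Lemma hat_iter_avgs X f r k : X != finset.set0 ->
  normc (hat (iter k (avgs X) f) r) =
  (normc (\sum_(s in X) chi r s) / #|X|%:R) ^+ k * normc (hat f r).
Proof.
move=> X0; elim: k => [|k IH]; first by rewrite mul1r.
by rewrite /= hat_avgs // IH exprS mulrA.
Qed.

Lemma iter_avgs_Bohr (Gamma : {set G}) (rho sigma : R) k x : 0 <= sigma ->
  x \in Bohr Gamma (rho - k%:R * sigma) ->
  iter k (avgs (Bohr Gamma sigma)) (ind R (Bohr Gamma rho)) x = 1.
Proof.
move=> s0; elim: k x => [|k IH] x; first by rewrite mul0r subr0 /= /ind => ->.
move=> hx /=; have B0 : Bohr Gamma sigma != finset.set0 by rewrite -card_gt0 Bohr_card_gt0.
rewrite /avgs -[RHS](expect_const _ B0) /expect; congr (_ * _).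
apply: eq_bigr => s hs; apply: IH.
by have := BohrD hx hs; rewrite -natr1 mulrDl mul1r opprD addrA subrK.
Qed.

Definition spec X r : bool := #|X|%:R <= 2 * normc (\sum_(s in X) chi r s).

(** Combinations with coefficients -1, 0, 1: the frequencies in the expansion of a Riesz product. *)
Fixpoint span Lam s : bool :=
  if Lam is l :: Lam' then [|| span Lam' s, span Lam' (s - l) | span Lam' (s + l)]
  else s == 0.

(* Ordered form of dissociativity: an element is only compared with the span of
   those after it, which is what the Riesz product needs. *)
Fixpoint dissociated (P : pred G) Lam : bool :=
  if Lam is l :: Lam' then
    dissociated P Lam' && [forall s, span Lam' s ==> ~~ P (l + s)]
  else true.

Lemma normc_span Lam s x (c : R) : (forall l, l \in Lam -> normc (chi l x - 1) <= c) ->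
  span Lam s -> normc (chi s x - 1) <= (size Lam)%:R * c.
Proof.
elim: Lam s => [|l Lam IH] s h /=.
  by move=> /eqP->; rewrite chi0l subrr normc0 mul0r.
have c0 : 0 <= c by apply: le_trans (normc_ge0 _) (h l _); rewrite inE eqxx.
have hl : normc (chi l x - 1) <= c by apply: h; rewrite inE eqxx.
have {}IH s' : span Lam s' -> normc (chi s' x - 1) <= (size Lam)%:R * c.
  by apply: IH => l' h'; apply: h; rewrite inE h' orbT.
rewrite -natr1 mulrDl mul1r.
have step s' l' : normc (chi l' x - 1) <= c -> span Lam s' ->
    normc (chi (s' + l') x - 1) <= (size Lam)%:R * c + c.
  move=> h1 /IH h2; rewrite !(chiC _ _ x) in h1 h2 *.
  by apply: le_trans (normc_chiD _ _ _ _) (lerD h2 h1).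
case/or3P => [/IH h'|/step h'|/step h'].
- by apply: le_trans h' _; rewrite lerDl.
- by rewrite -(subrK l s); apply: h'.
- by rewrite -(addrK l s); apply: h'; rewrite chiC normc_chiN chiC.
Qed.

Definition riesz (u : R) (om : G -> R[i]) Lam x : R :=
  \prod_(l <- Lam) (1 + u * complex.Re (om l * chi l x)).

(** Expanding one factor replaces the transform at [r] by those at [r], [r + l] and [r - l] with
    weights at most 1, [u / 2] and [u / 2]: total mass [1 + u] per factor. *)
Lemma riesz_hat_le u om Lam w r (K : R) : 0 <= u -> (forall l, normc (om l) <= 1) ->
  (forall s, span Lam s -> normc (hat w (r + s)) <= K) ->
  normc (hat (fun x => w x * riesz u om Lam x) r) <= (1 + u) ^+ size Lam * K.
Proof.
move=> u0 hom; elim: Lam r => [|l Lam IH] r hK.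
  rewrite expr0 mul1r; have := hK 0; rewrite /= eqxx addr0 => /(_ isT).
  rewrite (_ : (fun x => w x * riesz u om [::] x) = w) //.
  by apply/funext => x; rewrite /riesz big_nil mulr1.
set F := fun r => hat (fun x => w x * riesz u om Lam x) r.
have -> : hat (fun x => w x * riesz u om (l :: Lam) x) r =
    F r + (u / 2)%:C%C * (om l * F (r + l) + (om l)^*%C * F (r - l)).
  rewrite /F /hat !mulr_sumr -big_split /= mulr_sumr -big_split /=.
  apply: eq_bigr => x _; rewrite /riesz big_cons -/(riesz u om Lam x).
  rewrite !chiDl chiNl; move: (om l) (chi l x) (chi r x) (riesz _ _ _ _) => a b c W.
  have -> : a * ((w x * W)%:C%C * (c * b)) + a^*%C * ((w x * W)%:C%C * (c * b^*%C)) =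
      (a * b + (a * b)^*%C) * ((w x * W)%:C%C * c).
    by rewrite [(a * b)^*%C]rmorphM; ring.
  rewrite addcJ -(rmorph_nat (real_complex R) 2) !mulrA -!rmorphM mulrAC -mulrDl -rmorphD.
  by congr (_%:C%C * _); field.
have hF r' : (forall s, span Lam s -> normc (hat w (r' + s)) <= K) ->
   normc (F r') <= (1 + u) ^+ size Lam * K by exact: IH.
have h1 : normc (F r) <= (1 + u) ^+ size Lam * K.
  by apply: hF => s hs; apply: hK; rewrite /= hs.
have h2 : normc (F (r + l)) <= (1 + u) ^+ size Lam * K.
  by apply: hF => s hs; rewrite -addrA; apply: hK; rewrite /= addrAC subrr add0r hs orbT.
have h3 : normc (F (r - l)) <= (1 + u) ^+ size Lam * K.
  by apply: hF => s hs; rewrite -addrA; apply: hK; rewrite /= (addrC (- l)) subrK hs !orbT.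
apply: le_trans (le_normcD _ _) _.
have h4 : normc (om l * F (r + l) + (om l)^*%C * F (r - l)) <=
    2 * ((1 + u) ^+ size Lam * K).
  apply: le_trans (le_normcD _ _) _; rewrite !normcM normc_conj mulr_natl mulr2n.
  have om0 := normc_ge0 (om l); apply: lerD.
    by rewrite -[leRHS]mul1r; apply: ler_pM; rewrite ?normc_ge0.
  by rewrite -[leRHS]mul1r; apply: ler_pM; rewrite ?normc_ge0.
rewrite normcM normc_real ger0_norm ?divr_ge0 // exprS.
have -> : (1 + u) * (1 + u) ^+ size Lam * K =
    (1 + u) ^+ size Lam * K + u / 2 * (2 * ((1 + u) ^+ size Lam * K)) by field.
by apply: lerD => //; apply: ler_wpM2l; rewrite ?divr_ge0.
Qed.

(** Peeling off [l] adds [u] times a transform at [l], whose frequencies [l + s] all avoid [P] by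
    dissociativity; the added terms sum geometrically. *)
Lemma sum_riesz_le u om Lam w (P : pred G) (K : R) : 0 <= u ->
  (forall l, normc (om l) <= 1) -> 0 <= K ->
  (forall r, ~~ P r -> normc (hat w r) <= K) -> dissociated P Lam ->
  \sum_x w x * riesz u om Lam x <= \sum_x w x + (1 + u) ^+ size Lam * K.
Proof.
move=> u0 hom K0 hK; elim: Lam => [_|l Lam IH /= /andP[/IH {}IH /forallP hd]].
  rewrite expr0 mul1r ler_wpDr //; apply: ler_sum => x _.
  by rewrite /riesz big_nil mulr1.
have -> : \sum_x w x * riesz u om (l :: Lam) x = \sum_x w x * riesz u om Lam x +
    u * complex.Re (om l * hat (fun x => w x * riesz u om Lam x) l).
  rewrite /hat mulr_sumr Re_sum mulr_sumr -big_split /=; apply: eq_bigr => x _.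
  rewrite /riesz big_cons -/(riesz u om Lam x) [om l * _]mulrCA.
  have ReM (a : R) (z : R[i]) : complex.Re (a%:C%C * z) = a * complex.Re z.
    by case: z => b c /=; rewrite mul0r subr0.
  by rewrite ReM; ring.
have h : normc (hat (fun x => w x * riesz u om Lam x) l) <= (1 + u) ^+ size Lam * K.
  by apply: riesz_hat_le => // s hs; apply: hK; have := hd s; rewrite hs.
have h2 : complex.Re (om l * hat (fun x => w x * riesz u om Lam x) l) <=
    (1 + u) ^+ size Lam * K.
  apply: le_trans (ler_norm _) (le_trans (normc_Re _) _).
  by rewrite normcM -[leRHS]mul1r; apply: ler_pM; rewrite ?normc_ge0.
rewrite exprS -mulrA mulrDl mul1r addrA.
by apply: lerD => //; apply: ler_wpM2l.
Qed.

(** The factor that rotates [z] onto the nonnegative reals; it is 0 at [z = 0]. *)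
Definition phase (z : R[i]) : R[i] := z^*%C * (normc z)^-1%:C%C.

Lemma normc_phase z : normc (phase z) <= 1.
Proof.
rewrite /phase normcM normc_conj normc_real normfV ger0_norm ?normc_ge0 //.
have [->|h] := eqVneq (normc z) 0; first by rewrite mul0r ler01.
by rewrite divff.
Qed.

Lemma Re_phase z : complex.Re (phase z * z) = normc z.
Proof.
rewrite /phase; have [->|h] := eqVneq z 0; first by rewrite mulr0 normc0.
have h0 : normc z != 0 by apply: contraNneq h => /eq0_normc ->.
by rewrite mulrAC mul_conjc -rmorphM /= expr2 mulfK.
Qed.

Lemma expR_le_1D (v : R) : - 2^-1 <= v -> expR (v - 2 * v ^+ 2) <= 1 + v.
Proof.
move=> hv; have h : 0 < 1 - v + 2 * v ^+ 2.
  by have := sqr_ge0 (v - 4^-1); lra.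
apply: le_trans (expR_le_inv _) _; first by lra.
rewrite -div1r ler_pdivrMr; last by lra.
have : 0 <= v ^+ 2 * (1 + 2 * v) by rewrite mulr_ge0 ?sqr_ge0 //; lra.
by lra.
Qed.

(** On [T] the Riesz product is bounded below by an exponential, then Jensen applies. With weight
    [1 / 8], an element of the spectrum contributes at least [1 / 16] on average and the quadratic
    correction costs at most [1 / 32], leaving [1 / 32] for each. *)
Lemma dissociated_spec_size T w Lam (P : pred G) (K : R) : T != finset.set0 ->
  (forall x, 0 <= w x) -> (forall x, x \in T -> 1 <= w x) -> 0 <= K ->
  (forall r, ~~ P r -> normc (hat w r) <= K) -> dissociated P Lam ->
  (forall l, l \in Lam -> spec T l) ->
  #|T|%:R * expR ((size Lam)%:R / 32) <= \sum_x w x + (9 / 8) ^+ size Lam * K.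
Proof.
move=> T0 w0 w1 K0 hK hd hT; have t0 := card_neq0 R T0.
pose om l := phase (\sum_(t in T) chi l t).
have hom l : normc (om l) <= 1 by apply: normc_phase.
have e8 : 1 + 1 / 8 = 9 / 8 :> R by field.
have u0 : 0 <= 1 / 8 :> R by [].
have := sum_riesz_le u0 hom K0 hK hd; rewrite e8; apply: le_trans.
pose X l t := complex.Re (om l * chi l t).
have X1 l t : -1 <= X l t <= 1.
  rewrite -ler_norml; apply: le_trans (normc_Re _) _.
  by rewrite normcM normc_chi mulr1.
have factor l t : expR (1 / 8 * X l t - 1 / 32) <= 1 + 1 / 8 * X l t.
  have /andP[x1 x2] := X1 l t.
  apply: le_trans (expR_le_1D _); last by lra.
  have : 0 <= (1 - X l t) * (1 + X l t) by rewrite mulr_ge0; lra.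
  by rewrite ler_expR; lra.
have r0 t : expR (\sum_(l <- Lam) (1 / 8 * X l t - 1 / 32)) <= riesz (1 / 8) om Lam t.
  rewrite expR_sum /riesz; elim: (Lam) => [|l L IH]; first by rewrite !big_nil.
  by rewrite !big_cons ler_pM ?expR_ge0 // prodr_ge0 // => *; exact: expR_ge0.
have riesz0 t : 0 <= riesz (1 / 8) om Lam t.
  by apply: le_trans (r0 t); apply: expR_ge0.
apply: (@le_trans _ _ (\sum_(x in T) riesz (1 / 8) om Lam x)); last first.
  rewrite [leRHS](bigID (mem T)) /=; apply: ler_wpDr.
    by apply: sumr_ge0 => x _; rewrite mulr_ge0.
  by apply: ler_sum => x xT; rewrite ler_peMl // w1.
rewrite [leRHS]sum_expect // ler_pM2l //.
apply: le_trans (ler_expect (fun t _ => r0 t)).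
apply: le_trans (jensen_expR _ T0); rewrite ler_expR.
have -> : expect T (fun t => \sum_(l <- Lam) (1 / 8 * X l t - 1 / 32)) =
    \sum_(l <- Lam) (1 / 8 * expect T (X l) - 1 / 32).
  rewrite /expect exchange_big /= mulr_sumr; apply: eq_bigr => l _.
  rewrite sumrB -mulr_sumr mulrBr mulrCA; congr (_ - _).
  by rewrite -[RHS](expect_const _ T0).
have -> : (size Lam)%:R / 32 = \sum_(l <- Lam) (1 / 32 : R).
  by rewrite big_const_seq count_predT iter_addr_0 -[RHS]mulr_natl mulrA mulr1.
rewrite !big_seq; apply: ler_sum => l /hT hl.
have : 2^-1 <= expect T (X l).
  rewrite /expect /X -Re_sum -mulr_sumr Re_phase -ler_pdivrMl ?invr_gt0 // invrK.
  by move: hl; rewrite /spec; lra.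
by lra.
Qed.

(** Greedy extension: if [r] cannot be prepended to a dissociated list, some [s] in its span
    satisfies [P (r + s)]. *)
Lemma dissociated_maximal (P Q : pred G) k :
  (exists Lam, [/\ size Lam = k, all Q Lam & dissociated P Lam]) \/
  (exists Lam, [/\ (size Lam < k)%N, all Q Lam &
     forall r, Q r -> exists2 s, span Lam s & P (r + s)]).
Proof.
elim: k => [|k [[Lam [hs hQ hd]]|[Lam [hs hQ hr]]]]; first by left; exists [::].
  have [/existsP[r /andP[hr1 hr2]]|/existsPn h] :=
      boolP [exists r, Q r && dissociated P (r :: Lam)].
    by left; exists (r :: Lam); split; rewrite //= ?hs // hr1.
  right; exists Lam; split; rewrite ?hs // => r hr.
  have := h r; rewrite hr /= hd /= negb_forall => /existsP[s].
  by rewrite negb_imply negbK => /andP[? ?]; exists s.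
by right; exists Lam; split => //; rewrite ltnW.
Qed.

(* Chang's theorem relative to a Bohr set, by Riesz products against the
   majorant [iter L (avgs S') 1_{S+}] of [1_S]: its Fourier transform is at
   most [2 ^- L * #|S+|] outside the spectrum of [S']. *)
Lemma local_chang (Gamma : {set G}) (sigma sigma' : R) T (d L : nat) :
  let S := Bohr Gamma sigma in
  let S' := Bohr Gamma sigma' in
  (0 < d)%N -> 0 <= sigma -> 0 <= sigma' -> L%:R * sigma' <= sigma / (12 * d%:R) ->
  (#|Bohr Gamma ((1 + 1 / (12 * d%:R)) * sigma)| <= 2 * #|S|)%N ->
  T \subset S -> T != finset.set0 ->
  4 * #|S|%:R < #|T|%:R * expR (L%:R / 32 : R) ->
  exists Lam, [/\ (size Lam < L)%N, {in Lam, forall l, spec T l} &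
    forall r, spec T r -> exists2 s, span Lam s & spec S' (r + s)].
Proof.
move=> S S' d0 s0 s0' hL hS /fintype.subsetP TS T0 hT.
set rho := (1 + 1 / (12 * d%:R)) * sigma in hS.
have [[Lam [hs /allP hQ hd]]|[Lam [hs /allP hQ hr]]] :=
  @dissociated_maximal (spec S') (spec T) L; last by exists Lam.
have S0' : S' != finset.set0 by rewrite -card_gt0 Bohr_card_gt0.
pose w := iter L (avgs S') (ind R (Bohr Gamma rho)).
have w0 x : 0 <= w x by apply: avgs_ge0 => y; apply: ind_ge0.
have w1 x : x \in T -> 1 <= w x.
  (* The [L] averages use up [L * sigma'], within the margin [sigma / (12 * d)] by which [rho]
     exceeds [sigma]. *)
  move=> /TS xS; rewrite /w iter_avgs_Bohr //.
  move: x xS; apply/fintype.subsetP/BohrS => //.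
  by rewrite /rho mulrDl mul1r mul1r [_^-1 * _]mulrC; lra.
pose N : R := #|Bohr Gamma rho|%:R.
have hK r : ~~ spec S' r -> normc (hat w r) <= 2 ^- L * N.
  move=> hr; rewrite hat_iter_avgs // -exprVn ler_pM ?exprn_ge0 ?normc_ge0 //.
  - by rewrite divr_ge0 // normc_ge0.
  - rewrite lerXn2r ?nnegrE ?divr_ge0 ?normc_ge0 // ler_pdivrMr ?card_neq0 //.
    by move: hr; rewrite /spec -ltNge; clear; lra.
  - apply: le_trans (normc_sum _ _ _) _; rewrite /N -(sum_ind R).
    apply: ler_sum => x _; rewrite normcM normc_real normc_chi mulr1.
    by rewrite ger0_norm // ind_ge0.
have K0 : 0 <= 2 ^- L * N by rewrite mulr_ge0 // invr_ge0 exprn_ge0.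
have := dissociated_spec_size T0 w0 w1 K0 hK hd hQ.
rewrite sum_iter_avgs // sum_ind -/N hs.
(* The growth [(9 / 8) ^+ L] of the Riesz product is beaten by the [2 ^- L] of the [L] averages. A
   dissociated list of length [L] would thus bound [#|T| * expR (L / 32)] by [2 * N], hence by
   [4 * #|S|], a contradiction. *)
have : (9 / 8) ^+ L * (2 ^- L * N) <= N.
  rewrite mulrA -exprVn -exprMn ler_piMl // exprn_ile1 //; clear; lra.
have : N <= 2 * #|S|%:R by rewrite -natrM ler_nat.
by move: hT; rewrite -/S; clear; lra.
Qed.

Lemma normc_sumD (A B : {set G}) (F : G -> R[i]) : (forall x, normc (F x) <= 1) ->
  normc (\sum_(x in A) F x - \sum_(x in B) F x) <= #|A :\: B|%:R + #|B :\: A|%:R.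
Proof.
move=> hF; rewrite (big_setID B) [X in _ - X](big_setID A) /= (finset.setIC B A).
rewrite [X in X - _]addrC addrKA; apply: le_trans (le_normcD _ _) _; rewrite normcN.
have h (X : {set G}) : normc (\sum_(x in X) F x) <= #|X|%:R.
  apply: le_trans (normc_sum _ _ _) _; rewrite -sum1_card natr_sum.
  by apply: ler_sum => x _; apply: hF.
by apply: lerD.
Qed.

(** By regularity [S] and [S + x] differ in at most [24 * #|Gamma| * delta * #|S|] points, and the
    character sum over [S + x] is [chi r x] times that over [S]. The latter is at least half of
    [#|S|], which costs the last factor 2. *)
Lemma normc_chi_spec (Gamma : {set G}) (sigma delta : R) r x :
  (0 < #|Gamma|)%N -> 0 <= sigma -> regular_Bohr Gamma sigma ->
  0 <= delta <= 1 / (12 * #|Gamma|%:R) ->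
  spec (Bohr Gamma sigma) r -> x \in Bohr Gamma (delta * sigma) ->
  normc (chi r x - 1) <= 48 * #|Gamma|%:R * delta.
Proof.
move=> d0 s0 hreg /andP[de0 de1]; set S := Bohr Gamma sigma => hr hx.
have S0 : 0 < #|S|%:R :> R by rewrite ltr0n Bohr_card_gt0.
have := hreg delta; rewrite ger0_norm // => /(_ de1) /andP[_].
set B := Bohr Gamma _ => hB; rewrite ler_pdivrMr // in hB.
pose Sx := [set s + x | s in S].
have cSx : #|Sx| = #|S| by rewrite card_imset //; apply: addIr.
have SB : S \subset B by apply: BohrS => //; rewrite ler_peMl // lerDl.
have SxB : Sx \subset B.
  apply/fintype.subsetP => y /imsetP[s sS ->].
  by rewrite /B mulrDl mul1r BohrD.
have h1 : #|Sx :\: S|%:R <= 12 * #|Gamma|%:R * delta * #|S|%:R :> R.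
  apply: (@le_trans _ _ #|B :\: S|%:R); first by rewrite ler_nat subset_leq_card // finset.setSD.
  by rewrite cardsD (finset.setIidPr SB) natrB ?subset_leq_card //; lra.
have h2 : #|S :\: Sx|%:R <= 12 * #|Gamma|%:R * delta * #|S|%:R :> R.
  apply: (@le_trans _ _ #|B :\: Sx|%:R); first by rewrite ler_nat subset_leq_card // finset.setSD.
  by rewrite cardsD (finset.setIidPr SxB) cSx natrB -?cSx ?subset_leq_card // cSx; lra.
have := @normc_sumD Sx S (chi r) (fun y => _ : _ <= _); rewrite big_imset /=; last first.
  by move=> ? ? _ _; apply: addIr.
under eq_bigr do rewrite chiD.
rewrite -mulr_suml -{2}[\sum_(x in S) _]mulr1 -mulrBr normcM.
set z := normc (\sum_(_ in _) _) => /(_ _) h3.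
have {}h3 : z * normc (chi r x - 1) <= #|Sx :\: S|%:R + #|S :\: Sx|%:R.
  by apply: h3 => y; rewrite normc_chi.
have := normc_ge0 (chi r x - 1); set c := normc _ in h3 * => c0.
have h4 : #|S|%:R <= 2 * z := hr.
have h5 : #|S|%:R * c <= 2 * z * c by apply: ler_wpM2r.
rewrite -(ler_pM2l S0); lra.
Qed.

End Chang.

(** * Smoothing *)

Section Smoothing.
Variables (R : realType) (n : nat).
Local Notation G := 'I_n.+1.
Local Notation chi := (chi R).
Implicit Types (X T D Y Z : {set G}) (f : G -> R) (x y z r s t w b : G).

Definition chi_sum X r : R[i] := \sum_(s in X) chi r s.

Lemma parseval X : \sum_r normc (chi_sum X r) ^+ 2 = n.+1%:R * #|X|%:R.
Proof.
apply: (@complexI R); rewrite rmorph_sum /=.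
transitivity (\sum_r \sum_(s in X) \sum_(t in X) chi r (s - t)).
  apply: eq_bigr => r _; rewrite -mul_conjc mulrC /chi_sum mulr_suml; apply: eq_bigr => s _.
  by rewrite rmorph_sum mulr_sumr; apply: eq_bigr => t _; rewrite chiD chiN.
rewrite exchange_big /= rmorphM !rmorph_nat -sumr_const mulr_sumr.
apply: eq_bigr => s sX; rewrite exchange_big /= (bigD1 s) //= [X in _ + X]big1 => [|t /andP[_ ts]].
  by rewrite sum_chi subrr eqxx addr0 mulr1.
by rewrite sum_chi subr_eq0 eq_sym (negPf ts).
Qed.

Definition corr_coef D Y Z r : R[i] :=
  n.+1%:R^-1 * ((chi_sum D r)^*%C * (chi_sum Y r)^*%C * chi_sum Z r).

Lemma corrE D Y Z w :
  (corr R D Y Z w)%:C%C = \sum_r corr_coef D Y Z r * chi r w.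
Proof.
have N0 : n.+1%:R != 0 :> R[i] by rewrite pnatr_eq0.
have indE x : (ind R D x)%:C%C = n.+1%:R^-1 * \sum_r ((chi_sum D r)^*%C * chi r x).
  transitivity (n.+1%:R^-1 * \sum_(s in D) \sum_r chi r (x - s)); last first.
    congr (_ * _); rewrite exchange_big /=; apply: eq_bigr => r _.
    rewrite rmorph_sum mulr_suml; apply: eq_bigr => s _.
    by rewrite chiD chiN mulrC.
  rewrite /ind rmorph_nat; have [xD|xD] := boolP (x \in D).
    rewrite (bigD1 x) //= [X in _ + X]big1 => [|s /andP[_ sx]]; rewrite sum_chi subr_eq0 ?eqxx.
      by rewrite addr0 mulVf.
    by rewrite eq_sym (negPf sx).
  rewrite big1 ?mulr0 // => s sD; rewrite sum_chi subr_eq0; case: eqP => // xs.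
  by rewrite xs sD in xD.
rewrite /corr rmorph_sum /=.
under eq_bigr => y _ do rewrite rmorph_sum /=.
under eq_bigr => y _ do under eq_bigr => z _ do rewrite indE mulr_sumr.
under eq_bigr => y _ do rewrite exchange_big /=.
rewrite exchange_big /=; apply: eq_bigr => r _.
rewrite /corr_coef {3}/chi_sum.
transitivity (\sum_(y in Y) \sum_(z in Z)
   n.+1%:R^-1 * ((chi_sum D r)^*%C * ((chi r y)^*%C * (chi r z * chi r w)))).
  by apply: eq_bigr => y _; apply: eq_bigr => z _; rewrite !chiD chiN; ring.
rewrite -!mulrA; under eq_bigr do rewrite -mulr_sumr -mulr_sumr -mulr_sumr.
rewrite -!mulr_sumr; congr (_ * (_ * _)).
by rewrite -mulr_suml rmorph_sum -mulr_suml.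
Qed.

(** The factor of [Z] is bounded trivially, the other two by the arithmetic-geometric mean
    inequality and Parseval. *)
Lemma sum_corr_coef D Y Z :
  \sum_r normc (corr_coef D Y Z r) <= #|Z|%:R * ((#|D|%:R + #|Y|%:R) / 2).
Proof.
have N0 : 0 < n.+1%:R :> R by rewrite ltr0n.
apply: (@le_trans _ _ (\sum_r n.+1%:R^-1 * (#|Z|%:R *
   ((normc (chi_sum D r) ^+ 2 + normc (chi_sum Y r) ^+ 2) / 2)))).
  apply: ler_sum => r _; rewrite /corr_coef !normcM !normc_conj.
  have -> : normc (n.+1%:R^-1 : R[i]) = n.+1%:R^-1.
    by rewrite -(rmorph_nat (real_complex R)) -fmorphV normc_real ger0_norm ?invr_ge0.
  rewrite ler_wpM2l ?invr_ge0 // mulrC ler_pM ?mulr_ge0 ?normc_ge0 //.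
    rewrite /chi_sum; apply: le_trans (normc_sum _ _ _) _.
    by under eq_bigr do rewrite normc_chi; rewrite sumr_const.
  by have := sqr_ge0 (normc (chi_sum D r) - normc (chi_sum Y r)); clear; lra.
rewrite -mulr_sumr -mulr_sumr -mulr_suml big_split /= !parseval.
by rewrite le_eqVlt; apply/orP; left; apply/eqP; field; rewrite gt_eqF.
Qed.

Lemma iter_avgs_chi X f (c : G -> R[i]) k w :
  (forall x, (f x)%:C%C = \sum_r c r * chi r x) ->
  (iter k (avgs X) f w)%:C%C =
    \sum_r c r * ((#|X|%:R^-1)%:C%C * chi_sum X r) ^+ k * chi r w.
Proof.
move=> hf; elim: k w => [|k IH] w /=.
  by rewrite hf; apply: eq_bigr => r _; rewrite mulr1.
rewrite {1}/avgs /expect rmorphM rmorph_sum /=.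
under eq_bigr do rewrite IH.
rewrite exchange_big /= mulr_sumr; apply: eq_bigr => r _.
rewrite exprS /chi_sum; under eq_bigr do rewrite chiD mulrA.
by rewrite -mulr_sumr -/(chi_sum X r); ring.
Qed.

Lemma iter_avgs_close X f (c : R) k w : X != finset.set0 ->
  (forall x s, s \in X -> `|f (x + s) - f x| <= c) ->
  `|iter k (avgs X) f w - f w| <= k%:R * c.
Proof.
move=> X0 hc; elim: k w => [|k IH] w /=; first by rewrite subrr normr0 mul0r.
rewrite /avgs -(expect_const (f w) X0) expectB; apply: ler_norm_expect => // s sX.
rewrite -natr1 mulrDl mul1r -(subrKA (f (w + s))).
by apply: le_trans (ler_normD _ _) (lerD (IH _) (hc _ _ sX)).
Qed.

(* Averaging [k] times over differences of [T] hardly moves [corr], and it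
   makes the Fourier transform negligible off the spectrum of [T]. *)
Lemma corr_shift_le D Y Z T (c nu : R) k b : T != finset.set0 -> 0 <= nu ->
  (forall w t t', t \in T -> t' \in T ->
     `|corr R D Y Z (w + t) - corr R D Y Z (w + t')| <= c) ->
  (forall r, spec R T r -> normc (chi r b - 1) <= nu) -> 2 * 2 ^- k <= nu ->
  `|corr R D Y Z b - corr R D Y Z 0| <=
    2 * k%:R * c + nu * (#|Z|%:R * ((#|D|%:R + #|Y|%:R) / 2)).
Proof.
move=> T0 nu0 hc hspec hk; set f := corr R D Y Z.
have [t0 t0T] := set0Pn _ T0.
(* Translating [T] by one of its points keeps the absolute value of its transform, and a shift by an
   element of [X] compares two points of [T]. *)
pose X := [set t - t0 | t in T].
have cX : #|X| = #|T| by rewrite card_imset //; apply: addIr.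
have X0 : X != finset.set0 by rewrite -card_gt0 cX card_gt0.
have hX x s : s \in X -> `|f (x + s) - f x| <= c.
  move=> /imsetP[t tT ->]; have := hc (x - t0) t t0 tT t0T.
  by rewrite subrK addrAC -addrA.
have h w : `|iter k (avgs X) f w - f w| <= k%:R * c by apply: iter_avgs_close.
have {h} hb := h b; have := iter_avgs_close k 0 X0 hX; move: hb.
set A := iter k _ _ b; set B := iter k _ _ 0 => hb h0.
have hAB : `|A - B| <= nu * (#|Z|%:R * ((#|D|%:R + #|Y|%:R) / 2)).
  rewrite -normc_real rmorphB /= /A /B !(iter_avgs_chi _ _ _ (corrE D Y Z)) -sumrB.
  apply: le_trans (normc_sum _ _ _) _.
  apply: (@le_trans _ _ (nu * \sum_r normc (corr_coef D Y Z r))); last first.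
    by rewrite ler_wpM2l // sum_corr_coef.
  rewrite mulr_sumr; apply: ler_sum => r _.
  move: (corr_coef D Y Z r) => a.
  rewrite chi0 -mulrBr -mulrA !normcM normcX normcM [leRHS]mulrC.
  rewrite ler_wpM2l ?normc_ge0 // normc_real ger0_norm ?invr_ge0 //.
  have -> : normc (chi_sum X r) = normc (chi_sum T r).
    rewrite /chi_sum big_imset /=; last by move=> ? ? _ _; apply: addIr.
    by under eq_bigr do rewrite chiD; rewrite -mulr_suml normcM normc_chi mulr1.
  rewrite cX; have t0R := card_neq0 R T0.
  have m0 : 0 <= #|T|%:R^-1 * normc (chi_sum T r) by rewrite mulr_ge0 ?normc_ge0 ?invr_ge0.
  have m1 : #|T|%:R^-1 * normc (chi_sum T r) <= 1.
    rewrite ler_pdivrMl // mulr1; apply: le_trans (normc_sum _ _ _) _.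
    by under eq_bigr do rewrite normc_chi; rewrite sumr_const.
  have d2 : normc (chi r b - 1) <= 2.
    apply: le_trans (le_normcD _ _) _; rewrite normcN normc_chi normc1.
    by clear; lra.
  (* In the spectrum [chi r b] is within [nu] of 1; outside, the multiplier is at most [2 ^- k] and
     the distance at most 2. *)
  have [hr|hr] := boolP (spec R T r).
    rewrite -[leRHS]mul1r ler_pM ?exprn_ge0 ?normc_ge0 ?hspec //.
    by rewrite exprn_ile1.
  apply: le_trans hk; rewrite mulrC ler_pM ?exprn_ge0 ?normc_ge0 //.
  rewrite -exprVn lerXn2r ?nnegrE // ler_pdivrMl //.
  by move: hr; rewrite /spec -ltNge -/(chi_sum T r); clear; lra.
have -> : f b - f 0 = - (A - f b) + (A - B) + (B - f 0) by ring.
apply: le_trans (ler_normD _ _) _; apply: (le_trans (lerD (ler_normD _ _) (lexx _))).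
rewrite normrN; move: hb h0 hAB; set M := nu * _; clear.
by set a := `| _ |; set a' := `| _ |; set a'' := `| _ |; lra.
Qed.

End Smoothing.

(** * Choice of the parameters *)

Section Constants.
Variable R : realType.

Lemma ln2_ge : 2^-1 <= ln 2 :> R.
Proof.
rewrite -ler_expR lnK ?posrE //.
apply: le_trans (expR_le_inv _) _; first by clear; lra.
by rewrite (_ : 1 - 2^-1 = 2^-1) ?invrK //; clear; lra.
Qed.

Lemma ceil_nat (x : R) : 0 <= x -> exists2 k, (0 < k)%N & x < k%:R <= x + 1.
Proof.
move=> x0; have /andP[h1 h2] := truncn_itv x0.
by exists (Num.truncn x).+1; rewrite // h2 -natr1 lerD2r.
Qed.

Lemma ln_two_div_ge (b : R) : 0 < b <= 1 -> ln 2 <= ln (2 / b).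
Proof.
move=> /andP[b0 b1]; rewrite ler_ln ?posrE ?divr_gt0 // ler_pdivlMr //.
by rewrite ler_piMr.
Qed.

(** In [ln (8 / (eps * beta))] the term [- ln eps] is bounded by [eps^-1], which costs only powers
    of [eps^-1] in the end; rounding up is absorbed since [ln (2 / beta) / eps >= 1 / 2]. *)
Lemma iteration_count (eps beta : R) : 0 < eps <= 1 -> 0 < beta <= 1 ->
  exists k, [/\ (0 < k)%N, k%:R <= 14 * (ln (2 / beta) / eps) &
    2 * 2 ^- k <= eps * beta / 4].
Proof.
move=> /andP[e0 e1] hb; have lb := ln_two_div_ge hb; move: hb => /andP[b0 b1].
have l2 := ln2_ge; set l := ln (2 / beta) in lb *.
have l0 : 2^-1 <= l := le_trans l2 lb.
have le : l <= l / eps by rewrite ler_pdivlMr // ler_piMr //; move: l0; clear; lra.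
have ie : eps^-1 / 2 <= l / eps.
  by rewrite mulrC ler_pM2r ?invr_gt0.
have [|k k0 /andP[k1 k2]] := @ceil_nat (12 * (l / eps)).
  by move: l0 le; clear; lra.
exists k; split => //; first by move: l0 le k2; clear; lra.
have p2 : 0 < 2 ^+ k :> R by rewrite exprn_gt0.
have hl : l = ln 2 - ln beta by rewrite /l ln_div ?posrE.
have h : ln (8 / (eps * beta)) <= ln (2 ^+ k).
  rewrite ln_div ?posrE ?mulr_gt0 // lnM ?posrE // lnXn //.
  rewrite (_ : 8 = 2 ^+ 3); last by rewrite -natrX.
  rewrite lnXn // -[ln 2 *+ k]mulr_natl -[ln 2 *+ 3]mulr_natl.
  have h1 : - ln eps <= eps^-1.
    by rewrite -lnV ?posrE // ltW // ln_sublinear // invr_gt0.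
  have h2 : 2^-1 * (12 * (l / eps)) <= k%:R * ln 2.
    rewrite mulrC; apply: ler_pM => //; last exact: ltW.
    by move: l0 le; clear; lra.
  by move: h1 h2 hl l0 le ie lb l2; clear; lra.
rewrite ler_ln ?posrE ?divr_gt0 ?mulr_gt0 // in h.
rewrite ler_pdivrMr ?mulr_gt0 // in h.
rewrite -/(2 / 2 ^+ k) ler_pdivrMr //; move: h; clear; lra.
Qed.

Lemma log_dim_bound (l g eps eta : R) (k m L : nat) :
  0 < eps -> 0 < l -> 0 < g -> (0 < k)%N -> eta = eps / (8 * k%:R) ->
  k%:R <= 14 * (l / eps) -> m%:R <= 34 * (l / eta ^+ 2) -> L%:R <= 130 * (m%:R * g) ->
  L%:R <= 130 * (34 * (64 * 14 ^+ 2)) * (eps ^- 4 * l ^+ 3 * g).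
Proof.
move=> e0 l0 g0 k0 -> hk hm hL; have kR : 0 < k%:R :> R by rewrite ltr0n.
apply: le_trans hL _.
have hk2 : k%:R ^+ 2 <= (14 * (l / eps)) ^+ 2.
  by rewrite lerXn2r ?nnegrE ?mulr_ge0 ?invr_ge0 // ltW.
have -> : 130 * (34 * (64 * 14 ^+ 2)) * (eps ^- 4 * l ^+ 3 * g) =
    130 * (34 * (l / eps ^+ 2 * 64 * (14 * (l / eps)) ^+ 2) * g).
  by field; rewrite gt_eqF.
rewrite ler_pM2l // ler_pM2r //; apply: le_trans hm _.
have -> : l / (eps / (8 * k%:R)) ^+ 2 = l / eps ^+ 2 * 64 * k%:R ^+ 2.
  by field; rewrite !gt_eqF.
rewrite ler_pM2l // ler_pM2l // !mulr_gt0 // invr_gt0 exprn_gt0 //.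
Qed.

End Constants.

(** * From almost periods to a Bohr set *)

Section Main.
Variables (R : realType) (n : nat).
Local Notation G := 'I_n.+1.
Implicit Types (T D Y Z : {set G}).

(** By regularity the sums of [Z] and [S] lie in a dilate [W] of at most twice the size of the Bohr
    set, so [#|W| / #|Z| <= expR g]. The 32 is [8 * 4], as [6 * (2 / beta) <= 2 ^+ 3 * (2 / beta)]
    and [ln 2 <= ln (2 / beta)]. *)
Lemma almost_periods D Y Z (Gamma : {set G}) (rho sigma beta eta : R) m :
  let d : R := #|Gamma|%:R in
  let g : R := ln (2 / (#|Z|%:R / #|Bohr Gamma rho|%:R)) in
  (0 < #|Gamma|)%N -> 0 <= rho -> regular_Bohr Gamma rho ->
  0 <= sigma <= rho / (12 * d) ->
  Z \subset Bohr Gamma rho -> Y != finset.set0 -> Z != finset.set0 ->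
  (#|Y| <= #|D|)%N -> 0 < beta <= 1 -> #|D|%:R <= 2 / beta * #|Y|%:R ->
  0 < eta <= 1 -> (0 < m)%N -> 32 * ln (2 / beta) <= eta ^+ 2 * m%:R ->
  exists T, [/\ T \subset Bohr Gamma sigma,
    #|Bohr Gamma sigma|%:R <= 2 * (#|T|%:R * expR (m%:R * g)) &
    forall w t t', t \in T -> t' \in T ->
      `|corr R D Y Z (w + t) - corr R D Y Z (w + t')| <= 2 * eta * #|Y|%:R * #|Z|%:R].
Proof.
move=> d g d0 rho0 hreg /andP[s0 s1] /fintype.subsetP ZB Y0 Z0 YD hb DY heta m0 hm.
have dR : 0 < d by rewrite ltr0n.
have z0 := card_neq0 R Z0; have y0 := card_neq0 R Y0.
have B0 : 0 < #|Bohr Gamma rho|%:R :> R by rewrite ltr0n Bohr_card_gt0.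
set S := Bohr Gamma sigma; set W := Bohr Gamma ((1 + 1 / (12 * d)) * rho).
have S0 : S != finset.set0 by rewrite -card_gt0 Bohr_card_gt0.
have hW z s : z \in Z -> s \in S -> z + s \in W.
  move=> /ZB zB sS; have := BohrD zB sS; apply/fintype.subsetP/BohrS => //.
  by rewrite mulrDl mul1r lerD2l mul1r mulrC.
have W2 : #|W|%:R <= 2 * #|Bohr Gamma rho|%:R :> R.
  have c0 : 0 < 1 / (12 * d) by rewrite divr_gt0 // mulr_gt0.
  have := hreg (1 / (12 * d)); rewrite gtr0_norm // lexx => /(_ isT) /andP[_].
  rewrite ler_pdivrMr // (_ : 12 * d * _ = 1) //.
  by rewrite mulrC divfK // gt_eqF // mulr_gt0.
have lb := ln_two_div_ge hb; have b0 : 0 < beta by case/andP: hb.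
have h8 : 8 * ln (6 * (#|D|%:R / #|Y|%:R)) <= eta ^+ 2 * m%:R.
  apply: le_trans hm.
  have D0 : 0 < #|D|%:R :> R by apply: lt_le_trans y0 _; rewrite ler_nat.
  have DY' : #|D|%:R / #|Y|%:R <= 2 / beta by rewrite ler_pdivrMr.
  have b2 : 0 < 2 / beta by rewrite divr_gt0.
  have h6 : 6 * (#|D|%:R / #|Y|%:R) <= 2 ^+ 3 * (2 / beta).
    by rewrite -natrX; move: DY' b2; clear; lra.
  have : ln (6 * (#|D|%:R / #|Y|%:R)) <= ln (2 ^+ 3 * (2 / beta)).
    by rewrite ler_ln // posrE mulr_gt0 ?exprn_gt0 // divr_gt0.
  rewrite [ln (2 ^+ 3 * _)]lnM ?posrE ?exprn_gt0 // lnXn // -[ln 2 *+ 3]mulr_natl.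
  by move: lb; clear; lra.
have [T [TS hT hcl]] := croot_sisask m0 Y0 Z0 S0 YD hW heta h8.
exists T; split => //.
have eg : expR g = 2 * #|Bohr Gamma rho|%:R / #|Z|%:R.
  rewrite /g lnK ?posrE ?divr_gt0 // ; field; rewrite !gt_eqF //.
have zm : 0 < (#|Z| ^ m)%N%:R :> R by rewrite ltr0n expn_gt0 -(ltr0n R) z0.
rewrite -(ler_pM2r zm) -natrM; apply: (@le_trans _ _ (2 * (#|T| * #|W| ^ m))%N%:R).
  by rewrite ler_nat.
rewrite !natrM -!mulrA; apply: ler_wpM2l => //; apply: ler_wpM2l => //.
rewrite expRM_natl !natrX -exprMn lerXn2r ?nnegrE ?mulr_ge0 ?expR_ge0 //.
by rewrite eg divfK // gt_eqF.
Qed.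

(** In the radius, [sigma] and [sigma'] each cost [12 * d] for the regularity window and 8 for
    finding a regular radius, [sigma'] also costs [L] for the averages in Chang's theorem, and
    [delta] costs [96 * d]. The 32 is the 4 of [nu] times the 8 of the last regular radius. *)
Lemma almost_periodic_Bohr D Y Z (Gamma : {set G}) (rho beta eps : R) :
  let d : R := #|Gamma|%:R in
  let l : R := ln (2 / beta) in
  let g : R := ln (2 / (#|Z|%:R / #|Bohr Gamma rho|%:R)) in
  (0 < #|Gamma|)%N -> 0 <= rho <= 2 -> regular_Bohr Gamma rho ->
  Z \subset Bohr Gamma rho -> Y != finset.set0 -> Z != finset.set0 ->
  (#|Y| <= #|D|)%N -> 0 < beta <= 1 -> #|D|%:R <= 2 / beta * #|Y|%:R ->
  0 < eps <= 1 ->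
  exists (L : nat) (Gamma' : {set G}) (rho' : R),
    [/\ (0 < L)%N, L%:R <= 130 * (34 * (64 * 14 ^+ 2)) * (eps ^- 4 * l ^+ 3 * g) &
     [/\ regular_Bohr Gamma' rho', Bohr Gamma' rho' \subset Bohr Gamma rho,
      (#|Gamma'| <= #|Gamma| + L)%N,
      eps * beta * rho / (32 * (96 ^+ 3 * (d ^+ 3 * L%:R))) <= rho' &
      forall b, b \in Bohr Gamma' rho' ->
        `|corr R D Y Z b - corr R D Y Z 0| <= eps * #|Y|%:R * #|Z|%:R]].
Proof.
move=> d l g d0 /andP[rho0 rho2] hreg ZB Y0 Z0 YD hb DY heps.
have [e0 e1] := andP heps; have [b0 b1] := andP hb.
have dR : 1 <= d by rewrite ler1n.
have dR0 : 0 < d by rewrite ltr0n.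
have z0 := card_neq0 R Z0; have y0 := card_neq0 R Y0.
have B0 : 0 < #|Bohr Gamma rho|%:R :> R by rewrite ltr0n Bohr_card_gt0.
have l2 := @ln2_ge R; have l0 : 2^-1 <= l := le_trans l2 (ln_two_div_ge hb).
have lg : ln 2 <= g.
  apply: ln_two_div_ge; rewrite divr_gt0 //= ler_pdivrMr // mul1r.
  by rewrite ler_nat subset_leq_card.
have g0 : 2^-1 <= g := le_trans l2 lg.
have [k [k0 hk hk2]] := iteration_count heps hb; have kR : 0 < k%:R :> R by rewrite ltr0n.
(* The [2 * k] sampling errors then add up to half of the allowed error. *)
pose eta := eps / (8 * k%:R).
have k1 : 1 <= k%:R :> R by rewrite ler1n.
have heta : 0 < eta <= 1.
  rewrite /eta divr_gt0 ?mulr_gt0 //= ler_pdivrMr ?mulr_gt0 //.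
  by move: e1 k1; clear; lra.
have [eta0 eta1] := andP heta.
have leta : l <= l / eta ^+ 2.
  rewrite ler_pdivlMr ?exprn_gt0 // ler_piMr ?exprn_ile1 ?(ltW eta0) //.
  by move: l0; clear; lra.
have [|m m0 /andP[m1 m2]] := @ceil_nat R (32 * (l / eta ^+ 2)).
  by move: l0 leta; clear; lra.
have mR : 1 <= m%:R :> R by rewrite ler1n.
have hm : 32 * l <= eta ^+ 2 * m%:R.
  by rewrite [leRHS]mulrC -ler_pdivrMr ?exprn_gt0 // -mulrA ltW.
have mg : g <= m%:R * g by rewrite ler_peMl //; move: g0; clear; lra.
(* This gives [L / 32 > 4 * (m * g) >= m * g + 3 * ln 2]; the surplus factor [expR (3 * ln 2) = 8]
   secures the density condition of Chang's theorem. *)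
have [|L L0 /andP[L1 L2]] := @ceil_nat R (128 * (m%:R * g)).
  by move: mg g0; clear; lra.
have LR : 1 <= L%:R :> R by rewrite ler1n.
have LR0 : 0 < L%:R :> R by rewrite ltr0n.
have [|sigma [/andP[sig1 sig2] sreg]] := @regular_radius R n Gamma (rho / (12 * d)) d0.
  by rewrite divr_ge0 // mulr_ge0 // ltW.
have sig0 : 0 <= sigma.
  by apply: le_trans sig1; rewrite !divr_ge0 // mulr_ge0 // ltW.
have [|T [TS hT hcl]] := @almost_periods D Y Z Gamma rho sigma beta eta m d0 rho0 hreg _
   ZB Y0 Z0 YD hb DY heta m0 hm; first by rewrite sig0.
set S := Bohr Gamma sigma in TS hT.
have S0 : 0 < #|S|%:R :> R by rewrite ltr0n Bohr_card_gt0.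
have T0 : T != finset.set0.
  apply: contraTneq hT => ->; rewrite cards0 mul0r mulr0 -ltNge //.
have [|sigma' [/andP[sig1' sig2'] sreg']] :=
  @regular_radius R n Gamma (sigma / (12 * d) / L%:R) d0.
  by rewrite divr_ge0 // divr_ge0 // mulr_ge0 // ltW.
have sig0' : 0 <= sigma'.
  by apply: le_trans sig1'; rewrite !divr_ge0 // mulr_ge0 // ltW.
have hLs : L%:R * sigma' <= sigma / (12 * d).
  by rewrite mulrC -ler_pdivlMr.
have hS2 : (#|Bohr Gamma ((1 + 1 / (12 * d)) * sigma)| <= 2 * #|S|)%N.
  have c0 : 0 < 1 / (12 * d) by rewrite divr_gt0 // mulr_gt0.
  have := sreg (1 / (12 * d)); rewrite gtr0_norm // lexx => /(_ isT) /andP[_].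
  rewrite ler_pdivrMr // -(ler_nat R) natrM (_ : 12 * #|Gamma|%:R * _ = 1) //.
  by rewrite mulrC divfK // gt_eqF // mulr_gt0.
have hTL : 4 * #|S|%:R < #|T|%:R * expR (L%:R / 32 : R).
  have t0 := card_neq0 R T0.
  apply: (@le_lt_trans _ _ (#|T|%:R * (8 * expR (m%:R * g)))).
    by move: hT; rewrite -/g; clear; lra.
  rewrite ltr_pM2l // (_ : 8 = expR (3%:R * ln 2)); last first.
    by rewrite expRM_natl lnK ?posrE // -natrX.
  by rewrite -expRD ltr_expR; move: L1 lg mg; clear; lra.
have [Lam [hLam hLamT hspan]] :=
  local_chang d0 sig0 sig0' hLs hS2 TS T0 hTL.
(* By [#|D| <= 2 / beta * #|Y|], this [nu] costs the other half of the allowed error. *)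
pose nu := eps * beta / 4.
have nu0 : 0 < nu by rewrite divr_gt0 // mulr_gt0.
have eb : eps * beta <= 1 by rewrite mulr_ile1 // ltW.
have nu1 : nu <= 1 by rewrite /nu; move: eb; clear; lra.
pose c : R := 96 ^+ 3 * (d ^+ 3 * L%:R).
have c96 : 4 <= 96 ^+ 3 :> R.
  by apply: (@le_trans _ _ 96); [rewrite ler_nat | rewrite ler_eXnr // ler1n].
have c4 : 4 * L%:R <= c.
  rewrite /c; apply: ler_pM => //; by rewrite ler_peMl // exprn_ege1.
have c1 : L%:R <= c by move: c4 LR0; clear; lra.
have c0 : 0 < c by apply: lt_le_trans c1.
pose x := nu * rho / c.
have x0 : 0 <= x by rewrite divr_ge0 ?mulr_ge0 // ltW.
have xrho : x <= rho.
  rewrite /x ler_pdivrMr // mulrC ler_wpM2l // (le_trans nu1) //.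
  exact: le_trans c1.
have xL : L%:R * x <= nu / 2.
  have h : L%:R * rho <= c / 2.
    by have := ler_wpM2l (ltW LR0) rho2; move: c4; clear; lra.
  rewrite /x mulrA ler_pdivrMr // mulrCA -[nu / 2 * c]mulrA ler_pM2l //.
  by rewrite [_^-1 * _]mulrC.
(* Makes [48 * d * delta] equal to [nu / 2]. *)
pose delta := nu / (96 * d).
have delta0 : 0 <= delta by rewrite divr_ge0 ?mulr_ge0 // ltW.
have delta1 : delta <= 1 / (12 * d).
  rewrite ler_pdivrMr ?mulr_gt0 // mul1r mulrC ler_pdivlMr ?mulr_gt0 //.
  by move: nu1 dR0; clear; nra.
have xsig : x <= delta * sigma'.
  have -> : x = delta * (rho / (12 * d) / 8 / (12 * d) / L%:R / 8).
    by rewrite /x /delta /c; field; rewrite !gt_eqF.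
  apply: ler_wpM2l => //; apply: le_trans sig1'.
  rewrite ler_wpM2r ?invr_ge0 // ler_wpM2r ?invr_ge0 // ler_wpM2r ?invr_ge0 //.
  by rewrite mulr_ge0 // ltW.
pose Gamma' : {set G} := Gamma :|: [set r in Lam].
have GG' : Gamma \subset Gamma' by apply: finset.subsetUl.
have d0' : (0 < #|Gamma'|)%N by apply: leq_trans d0 (subset_leq_card GG').
have [rho' [/andP[r1 r2] rreg]] := regular_radius d0' x0.
exists L, Gamma', rho'; split => //.
  apply: (log_dim_bound (eta := eta) (k := k) (m := m)) => //.
  - by apply: lt_le_trans l0.
  - by apply: lt_le_trans g0.
  - by move: m2 l0 leta; clear; lra.
  - by move: L2 mg g0; clear; lra.
split => //.
- by apply: BohrS => //; apply: le_trans xrho.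
- rewrite /Gamma' cardsU; apply: leq_trans (leq_subr _ _) _; rewrite leq_add2l.
  apply: leq_trans (ltnW hLam); apply: leq_trans (card_size Lam).
  by apply: subset_leq_card; apply/fintype.subsetP => r; rewrite inE.
- apply: le_trans r1; rewrite -/c /x /nu.
  by rewrite le_eqVlt; apply/orP; left; apply/eqP; field; rewrite gt_eqF.
move=> b hb'.
have hspecT r : spec R T r -> normc (chi R r b - 1) <= nu.
  (* [r] is the difference of [r + s], in the spectrum of the inner Bohr set and controlled by its
     regularity, and [s], in the span of [Lam] and controlled by the frequencies added to [Gamma];
     each accounts for [nu / 2]. *)
  move=> /hspan[s hs hrs].
  have h1 : normc (chi R (r + s) b - 1) <= nu / 2.
    apply: le_trans (normc_chi_spec (delta := delta) d0 sig0' sreg' _ hrs _) _.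
    - by rewrite delta0 delta1.
    - move: hb'; apply/fintype.subsetP/BohrS => //; exact: le_trans xsig.
    - rewrite /delta le_eqVlt; apply/orP; left; apply/eqP; field.
      by rewrite gt_eqF.
  have h2 : normc (chi R s b - 1) <= nu / 2.
    apply: le_trans xL; apply: le_trans (normc_span (c := x) _ hs) _.
      move=> r' r'L; apply: le_trans r2; move/mem_Bohr: hb'; apply.
      by rewrite !inE r'L orbT.
    by rewrite ler_wpM2r // ler_nat ltnW.
  have -> : r = (r + s) + (- s) by rewrite addrK.
  rewrite chiC; apply: le_trans (normc_chiD _ _ _ _) _.
  rewrite normc_chiN !(chiC _ b); apply: le_trans (lerD h1 h2) _.
  by clear; lra.
apply: le_trans (corr_shift_le T0 (ltW nu0) hcl hspecT hk2) _.
have -> : 2 * k%:R * (2 * eta * #|Y|%:R * #|Z|%:R) = eps / 2 * (#|Y|%:R * #|Z|%:R).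
  by rewrite /eta; field; rewrite gt_eqF.
have hYD : #|Y|%:R <= #|D|%:R :> R by rewrite ler_nat.
have : nu * (#|Z|%:R * ((#|D|%:R + #|Y|%:R) / 2)) <= eps / 2 * (#|Y|%:R * #|Z|%:R).
  have -> : eps / 2 * (#|Y|%:R * #|Z|%:R) = nu * (#|Z|%:R * (2 / beta * #|Y|%:R)).
    by rewrite /nu; field; rewrite gt_eqF.
  rewrite ler_pM2l // ler_pM2l //; apply: le_trans DY.
  by move: hYD; clear; lra.
by clear; lra.
Qed.

End Main.

(** * From counts to normalised averages *)

Theorem theorem2p6 (R : realType) :
  exists C : R, 0 < C /\
  forall (n d : nat) (eps : R)
    (Gamma1 Gamma2 : {set 'I_n.+1}) (rho1 rho : R)
    (Y Z D : {set 'I_n.+1}),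
  let B1 := Bohr Gamma1 rho1 in
  let B2 := Bohr Gamma2 rho in
  let beta : R := #|Y|%:R / #|B1|%:R in
  let gamma : R := #|Z|%:R / #|B2|%:R in
  (0 < d)%N -> 0 < eps <= 1 ->
  0 <= rho1 -> 0 <= rho <= 2 ->
  #|Gamma1| = d -> #|Gamma2| = d ->
  regular_Bohr Gamma1 rho1 -> regular_Bohr Gamma2 rho ->
  Y \subset B1 -> Z \subset B2 -> Y != finset.set0 -> Z != finset.set0 ->
  (#|Y| <= #|D|)%N -> (#|D| <= 2 * #|B1|)%N ->
  exists d' : R,
    [/\ 0 < d',
        d' <= C * eps ^- 4 * ln (2 * beta^-1) ^+ 3 * ln (2 * gamma^-1) &
    exists (Gamma' : {set 'I_n.+1}) (rho' : R),
      let B' := Bohr Gamma' rho' in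
      [/\ regular_Bohr Gamma' rho',
          B' \subset B2,
          #|Gamma'|%:R <= d%:R + d',
          rho * eps * beta / (24 * d%:R ^+ 3 * d') <= rho' &
      `| \E_(b in B') \E_(y in B1) \E_(z in B2)
            (ind R D (z - y + b) * ind R Y y * ind R Z z)
         - \E_(y in B1) \E_(z in B2)
            (ind R D (z - y) * ind R Y y * ind R Z z) |
        <= eps * beta * gamma]].
Proof.
(* [K] is [32 * 96 ^+ 3 / 24]: with [d' = K * L] the radius bound takes the required form, and
   [L <= d'] still bounds the added rank. *)
have [K KE] : exists K : R, K = 4 / 3 * 96 ^+ 3 by eexists.
have [C0 C0E] : exists C0 : R, C0 = 130 * (34 * (64 * 14 ^+ 2)) by eexists.
have K1 : 1 <= K.
  have : 1 <= 96 ^+ 3 :> R by rewrite exprn_ege1 // ler1n.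
  by rewrite KE; set u := _ ^+ 3; clearbody u; lra.
have C00 : 0 < C0 by rewrite C0E !mulr_gt0 // exprn_gt0.
have K0 : 0 < K by apply: lt_le_trans K1.
exists (K * C0); split; first by rewrite mulr_gt0.
move=> n d eps Gamma1 Gamma2 rho1 rho Y Z D B1 B2 beta gamma d0 heps r1 r2 G1 G2 reg1 reg2.
move=> YB ZB Y0 Z0 YD DB; have [e0 e1] := andP heps.
have y0 := card_neq0 R Y0; have z0 := card_neq0 R Z0.
have B10 : 0 < #|B1|%:R :> R by rewrite ltr0n Bohr_card_gt0.
have B20 : 0 < #|B2|%:R :> R by rewrite ltr0n Bohr_card_gt0 //; case/andP: r2.
have hb : 0 < beta <= 1.
  rewrite /beta divr_gt0 //= ler_pdivrMr // mul1r.
  by rewrite ler_nat subset_leq_card.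
have b0 : 0 < beta by case/andP: hb.
have DY : #|D|%:R <= 2 / beta * #|Y|%:R.
  have -> : 2 / beta * #|Y|%:R = (2 * #|B1|)%N%:R.
    by rewrite /beta natrM; field; rewrite !gt_eqF.
  by rewrite ler_nat.
have dG : (0 < #|Gamma2|)%N by rewrite G2.
have [L [Gamma' [rho' [L0 hL [rreg BB' hcard hrho hcorr]]]]] :=
  almost_periodic_Bohr dG r2 reg2 ZB Y0 Z0 YD hb DY heps.
rewrite -/B2 -/gamma -C0E in hL; rewrite G2 in hcard hrho.
have LR : 0 < L%:R :> R by rewrite ltr0n.
exists (K * L%:R); split; first by rewrite mulr_gt0.
  by rewrite -!mulrA ler_pM2l //; apply: le_trans hL _; rewrite -!mulrA.
exists Gamma', rho'; split => //.
- apply: (@le_trans _ _ (d%:R + L%:R)); first by rewrite -natrD ler_nat.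
  by rewrite lerD2l ler_peMl // ltW.
- apply: le_trans hrho; rewrite le_eqVlt; apply/orP; left; apply/eqP.
  by rewrite KE; field; rewrite !gt_eqF // ltr0n.
have avgE (F : 'I_n.+1 -> 'I_n.+1 -> R) :
    \E_(y in B1) \E_(z in B2) (F y z * ind R Y y * ind R Z z) =
    (\sum_(y in Y) \sum_(z in Z) F y z) / (#|B1|%:R * #|B2|%:R).
  have sub (A B : {set 'I_n.+1}) (f : 'I_n.+1 -> R) : A \subset B ->
      \sum_(x in B) f x * ind R A x = \sum_(x in A) f x.
    move=> AB; rewrite (big_setID A) /= (finset.setIidPr AB) [X in _ + X]big1 ?addr0.
      by apply: eq_bigr => x xA; rewrite /ind xA mulr1.
    by move=> x; rewrite inE => /andP[/negPf xA _]; rewrite /ind xA mulr0.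
  rewrite /expect; under eq_bigr do rewrite sub //.
  rewrite -mulr_sumr; under eq_bigr do rewrite -mulr_suml.
  by rewrite sub // invfM mulrA mulrC.
have B'0 : Bohr Gamma' rho' != finset.set0.
  rewrite -card_gt0 Bohr_card_gt0 //; apply: le_trans hrho.
  rewrite divr_ge0 ?mulr_ge0 ?exprn_ge0 // ?(ltW e0) ?(ltW b0) //.
  by case/andP: r2.
have corr0 : \E_(y in B1) \E_(z in B2) (ind R D (z - y) * ind R Y y * ind R Z z) =
    corr R D Y Z 0 / (#|B1|%:R * #|B2|%:R).
  rewrite (avgE (fun y z => ind R D (z - y))); congr (_ / _).
  by apply: eq_bigr => y _; apply: eq_bigr => z _; rewrite addr0.
rewrite corr0 -[X in _ - X](expect_const _ B'0) expectB.
apply: ler_norm_expect => // b hb'.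
rewrite (avgE (fun y z => ind R D (z - y + b))) -mulrBl normrM.
rewrite [`| _^-1|]ger0_norm ?invr_ge0 ?mulr_ge0 // ler_pdivrMr ?mulr_gt0 //.
apply: le_trans (hcorr b hb') _.
rewrite le_eqVlt; apply/orP; left; apply/eqP.
by rewrite /beta /gamma; field; rewrite !gt_eqF.
Qed.
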